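(* Let $T$ be a (not necessarily invertible) measure-preserving ergodic map of a Lebesgue probability space $(X,\mathcal{F},\mu)$. Suppose that for every non-trivial finite measurable partition $\zeta$ of $X$ one has $\underline{\mathcal{R}}_{\zeta}(x)\geq 1$ for $\mu$-almost every $x\in X$. Then $(X,\mathcal{F},\mu,T)$ is weakly mixing.
   Context: For a measurable set $U\subseteq X$ and $x\in U$, the first return time is $\tau_U(x)=\inf\{k\geq 1: T^k x\in U\}$, and the Poincaré recurrence of $U$ is $\tau(U)=\inf\{\tau_U(x): x\in U\}=\inf\{k>0: T^kU\cap U\neq\emptyset\}$. For a finite measurable partition $\zeta$ of $X$, let $\zeta_n=\zeta\vee T^{-1}\zeta\vee\cdots\vee T^{-n+1}\zeta$ ($\zeta_1=\zeta$) and let $\zeta_n(x)$ be the atom of $\zeta_n$ containing $x$. The lower local rate of Poincaré recurrence is $\underline{\mathcal{R}}_{\zeta}(x)=\liminf_{n\to\infty}\tau(\zeta_n(x))/n$. A partition is non-trivial if none of its atoms has measure $0$ or $1$. *)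

(* Defs.v *)
From HB Require Import structures.
From mathcomp Require Import all_boot all_order all_algebra.
From mathcomp Require Import all_classical all_reals all_analysis.
Set Implicit Arguments. Unset Strict Implicit. Unset Printing Implicit Defensive.
Import Order.TTheory GRing.Theory Num.Theory.
Import numFieldNormedType.Exports.
Local Open Scope classical_set_scope.
Local Open Scope ring_scope.

Section defs.
Context {d : measure_display} {X : measurableType d} {R : realType}.

(* Lebesgue (standard) probability space, Rokhlin-style: the measure is
   complete, and there is a measurable map f : X -> R, injective off a null
   set N, which generates the sigma-algebra mod 0 and whose image contains a
   Borel set of full measure. *)
Definition lebesgue_space (mu : probability X R) : Prop :=
  (forall A B : set X, measurable B -> mu B = 0%E -> A `<=` B -> measurable A)
  /\ exists f : X -> R, measurable_fun setT f /\
     exists N : set X, [/\ measurable N, mu N = 0%E,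
       {in ~` N &, injective f},
       (forall A : set X, measurable A -> exists B : set R, measurable B /\
           mu ((A `\` f @^-1` B) `|` (f @^-1` B `\` A)) = 0%E) &
       exists C : set R, [/\ measurable C, C `<=` f @` (~` N) &
                              mu (f @^-1` C) = 1%E]].

Definition measure_preserving (mu : probability X R) (T : X -> X) : Prop :=
  measurable_fun setT T /\
  forall A : set X, measurable A -> mu (T @^-1` A) = mu A.

Definition ergodic (mu : probability X R) (T : X -> X) : Prop :=
  forall A : set X, measurable A -> T @^-1` A = A ->
    mu A = 0%E \/ mu A = 1%E.

Definition finite_meas_partition (k : nat) (P : 'I_k -> set X) : Prop :=
  [/\ forall i, measurable (P i),
      forall i j, i != j -> P i `&` P j = set0 &
      \bigcup_(i in [set: 'I_k]) P i = setT].

Definition nontrivial_partition (mu : probability X R) (k : nat)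
    (P : 'I_k -> set X) : Prop :=
  forall i, mu (P i) != 0%E /\ mu (P i) != 1%E.

(* zeta_n(x): the atom of zeta v T^-1 zeta v ... v T^-(n-1) zeta containing x *)
Definition atom_n (T : X -> X) (k : nat) (P : 'I_k -> set X) (n : nat) (x : X)
  : set X :=
  [set y | forall j, (j < n)%N ->
     exists i, P i (iter j T x) /\ P i (iter j T y)].

(* Poincare recurrence tau(U) = inf {k > 0 | T^k U meets U}  (+oo if empty) *)
Definition poincare_rec (T : X -> X) (U : set X) : \bar R :=
  ereal_inf [set (k%:R)%:E | k in
     [set k : nat | (0 < k)%N /\ exists x, U x /\ U (iter k T x)]].

Definition lower_rec_rate (T : X -> X) (k : nat) (P : 'I_k -> set X) (x : X)
  : \bar R :=
  limn_einf (fun n : nat => (poincare_rec T (atom_n T P n x) / (n%:R)%:E)%E).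

Definition weakly_mixing (mu : probability X R) (T : X -> X) : Prop :=
  forall A B : set X, measurable A -> measurable B ->
    (fun n : nat => n%:R^-1 * \sum_(j < n)
       `| fine (mu ((iter j T) @^-1` A `&` B)) - fine (mu A) * fine (mu B) |)
    @ \oo --> (0 : R).

End defs.

(* Main.v *)
Require Import Defs.
From HB Require Import structures.
From mathcomp Require Import all_boot all_order all_algebra.
From mathcomp Require Import all_classical all_reals all_analysis.
From mathcomp Require Import measurable_realfun ring lra zify.
Set Implicit Arguments. Unset Strict Implicit. Unset Printing Implicit Defensive.
Import Order.TTheory GRing.Theory Num.Theory.
Import numFieldNormedType.Exports.
Local Open Scope classical_set_scope.
Local Open Scope ring_scope.

(* If T is not weakly mixing, it has a circle rotation as a factor, and a rotation
   returns too fast for a suitable two-set partition.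

   Eigenfunction.  Put f = 1_A - mu A and let S_N(t) be the squared L^2 norm of
   N^-1 sum_(j < N) e^(i j t) f o T^j.  By von Neumann's inequality for isometries
   (obtained from Fourier analysis on roots of unity), if S_N tends to 0 uniformly
   in t, then the Cesaro means of |mu(T^-j A `&` B) - mu A mu B| tend to 0.  Along
   N = 2^k the functions S_N are continuous and decreasing, so by Dini it is
   enough that they tend to 0 pointwise.  Otherwise, for some t, the averages are
   Cauchy with a nonzero limit z, and z = e^(i t) (z o T); by ergodicity z vanishes
   almost nowhere and its argument is a factor map onto a rotation by some alpha in ]0, 1[.

   Fast return.  Partition X by whether the rotation step wraps around 0.  If
   |r alpha - m| is minimal among all |i alpha - k| with 0 < i < N, the codes of x
   and T^r x agree up to time n unless the orbit of x meets an arc of measure at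
   most 1 / N before time n.  Consecutive Farey approximations of alpha provide
   infinitely many such r with N >= 3 r / 2, so n = 5 r / 4 gives a set of measure
   at least 1 / 6 where the return time of the n-cylinder of x is at most 8 n / 9. *)

(** * Semi-inner products and the mean ergodic theorem *)

(** Definiteness is not asked for: [l2ip] below acts on genuine functions and vanishes on those that
    are null almost everywhere, so no quotient has to be formed. *)
Definition semi_inner (R : realType) (H : lmodType R) (ip : H -> H -> R) :=
  [/\ forall x y, ip x y = ip y x,
      forall x y z, ip (x + y) z = ip x z + ip y z,
      forall a x y, ip (a *: x) y = a * ip x y &
      forall x, 0 <= ip x x].

Definition linear_isometry (R : realType) (H : lmodType R) (ip : H -> H -> R)
    (W : H -> H) :=
  [/\ forall x y, W (x + y) = W x + W y,
      forall a x, W (a *: x) = a *: W x &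
      forall x y, ip (W x) (W y) = ip x y].

Section semi_inner_theory.
Context (R : realType) (H : lmodType R) (ip : H -> H -> R) (ipP : semi_inner ip).

Let ipC : forall x y, ip x y = ip y x. Proof. by case: ipP. Qed.
Let ipDl : forall x y z, ip (x + y) z = ip x z + ip y z.
Proof. by case: ipP. Qed.
Let ipZl : forall a x y, ip (a *: x) y = a * ip x y. Proof. by case: ipP. Qed.
Let ip_ge0 : forall x, 0 <= ip x x. Proof. by case: ipP. Qed.

Lemma ipDr x y z : ip z (x + y) = ip z x + ip z y.
Proof. by rewrite ipC ipDl !(ipC z). Qed.

Lemma ipZr a x y : ip y (a *: x) = a * ip y x.
Proof. by rewrite ipC ipZl ipC. Qed.

Lemma ip_suml (I : Type) (s : seq I) (F : I -> H) y :
  ip (\sum_(i <- s) F i) y = \sum_(i <- s) ip (F i) y.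
Proof.
elim: s => [|i s IH]; last by rewrite !big_cons ipDl IH.
by rewrite !big_nil -(scale0r 0) ipZl mul0r.
Qed.

Lemma ip_sumr (I : Type) (s : seq I) (F : I -> H) y :
  ip y (\sum_(i <- s) F i) = \sum_(i <- s) ip y (F i).
Proof. by rewrite ipC ip_suml; apply: eq_bigr => i _; rewrite ipC. Qed.

Lemma ip_sqrD x y : ip (x + y) (x + y) = ip x x + 2 * ip x y + ip y y.
Proof. by rewrite ipDl !ipDr (ipC y x); ring. Qed.

Lemma ip_sqrZ a x : ip (a *: x) (a *: x) = a ^+ 2 * ip x x.
Proof. by rewrite ipZl ipZr; ring. Qed.

Lemma ip_sqrB x y : ip (x - y) (x - y) = ip x x - 2 * ip x y + ip y y.
Proof. by rewrite -scaleN1r ip_sqrD ip_sqrZ ipZr; ring. Qed.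

Lemma cauchy_schwarz x y : ip x y ^+ 2 <= ip x x * ip y y.
Proof.
have h t : 0 <= ip x x - 2 * t * ip x y + t ^+ 2 * ip y y.
  by have := ip_ge0 (x - t *: y); rewrite ip_sqrB ip_sqrZ ipZr; congr (_ <= _); ring.
have [y0|] := eqVneq (ip y y) 0.
  rewrite y0 mulr0; have [->|n0] := eqVneq (ip x y) 0; first by rewrite expr0n.
  (* When [ip y y = 0] the quadratic [h] is affine in [t]; at this [t] it takes the value -1. *)
  have := h ((ip x x + 1) / (2 * ip x y)); rewrite y0.
  suff -> : 2 * ((ip x x + 1) / (2 * ip x y)) * ip x y = ip x x + 1 by lra.
  by field.
move=> y0; have yp : 0 < ip y y by rewrite lt_neqAle eq_sym y0 ip_ge0.
have := h (ip x y / ip y y).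
have -> : ip x x - 2 * (ip x y / ip y y) * ip x y + (ip x y / ip y y) ^+ 2 * ip y y
  = (ip x x * ip y y - ip x y ^+ 2) / ip y y by field.
by rewrite pmulr_lge0 ?invr_gt0// subr_ge0.
Qed.

Definition ipnorm x := Num.sqrt (ip x x).

Lemma ipnorm_ge0 x : 0 <= ipnorm x. Proof. exact: sqrtr_ge0. Qed.

Lemma sqr_ipnorm x : ipnorm x ^+ 2 = ip x x. Proof. exact: sqr_sqrtr. Qed.

Lemma ler_ip_ipnorm x y : ip x y <= ipnorm x * ipnorm y.
Proof.
rewrite /ipnorm -sqrtrM// (le_trans (ler_norm _))// -sqrtr_sqr ler_sqrt ?cauchy_schwarz//.
by rewrite mulr_ge0.
Qed.

Lemma ler_ipnormD x y : ipnorm (x + y) <= ipnorm x + ipnorm y.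
Proof.
rewrite -(@ler_pXn2r _ 2)// ?nnegrE ?addr_ge0 ?ipnorm_ge0//.
rewrite sqr_ipnorm ip_sqrD sqrrD !sqr_ipnorm -mulr_natl.
by have := ler_ip_ipnorm x y; lra.
Qed.

Lemma ipnormZ a x : ipnorm (a *: x) = `|a| * ipnorm x.
Proof. by rewrite /ipnorm ip_sqrZ sqrtrM ?sqr_ge0// sqrtr_sqr. Qed.

Lemma ler_ipnormB x y : ipnorm (x - y) <= ipnorm x + ipnorm y.
Proof.
by rewrite (le_trans (ler_ipnormD _ _))// -scaleN1r ipnormZ normrN1 mul1r.
Qed.

Lemma ip_sqr_mid x y :
  ip (2^-1 *: (x + y)) (2^-1 *: (x + y)) <= (ip x x + ip y y) / 2.
Proof.
by have := ip_ge0 (x - y); rewrite ip_sqrB ip_sqrZ ip_sqrD; lra.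
Qed.

End semi_inner_theory.

Section mean_ergodic.
Context (R : realType) (H : lmodType R) (ip : H -> H -> R) (ipP : semi_inner ip).
Context (W : H -> H) (WP : linear_isometry ip W).

Let WD : forall x y, W (x + y) = W x + W y. Proof. by case: WP. Qed.
Let WZ : forall a x, W (a *: x) = a *: W x. Proof. by case: WP. Qed.
Let W_ip : forall x y, ip (W x) (W y) = ip x y. Proof. by case: WP. Qed.
Let ip_ge0 : forall x, 0 <= ip x x. Proof. by case: ipP. Qed.

Lemma iter_isometry n : linear_isometry ip (iter n W).
Proof.
elim: n => [|n [D Z I]]; first by split.
by split=> [x y|a x|x y] /=; rewrite ?D ?WD ?Z ?WZ ?W_ip.
Qed.

Lemma isometry_sum (I : Type) (s : seq I) (F : I -> H) :
  W (\sum_(i <- s) F i) = \sum_(i <- s) W (F i).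
Proof.
elim: s => [|i s IH]; last by rewrite !big_cons WD IH.
by rewrite !big_nil -(scale0r 0) WZ !scale0r.
Qed.

Definition erg_avg N x := N%:R^-1 *: \sum_(j < N) iter j W x.

Lemma erg_avgD N x y : erg_avg N (x + y) = erg_avg N x + erg_avg N y.
Proof.
rewrite /erg_avg -scalerDr -big_split/=; congr (_ *: _); apply: eq_bigr => i _.
by case: (iter_isometry i).
Qed.

Lemma erg_avg_double N x : (0 < N)%N ->
  erg_avg (N + N) x = 2^-1 *: (erg_avg N x + iter N W (erg_avg N x)).
Proof.
move=> N0; rewrite /erg_avg big_split_ord/=.
have [_ Z _] := iter_isometry N; rewrite Z -scalerDr scalerA.
congr (_ *: (_ + _)).
  by rewrite addnn -mul2n natrM invfM.
elim/big_rec2: _ => [|i y x' _ ->]; first by rewrite -(scale0r 0) Z !scale0r.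
by have [D _ _] := iter_isometry N; rewrite D iterD.
Qed.

(** The average of length [2 N] is the midpoint of the average of length [N] and its image under
    [iter N W], which has the same norm; convexity concludes. This is why averages are taken along
    powers of two. *)
Lemma erg_avg_double_le N x : (0 < N)%N ->
  ip (erg_avg (N + N) x) (erg_avg (N + N) x) <= ip (erg_avg N x) (erg_avg N x).
Proof.
move=> N0; rewrite erg_avg_double//.
apply: le_trans (ip_sqr_mid ipP _ _) _.
by case: (iter_isometry N) => _ _ ->; lra.
Qed.

Lemma erg_avg_pow2_le k x : ip (erg_avg (2 ^ k) x) (erg_avg (2 ^ k) x) <= ip x x.
Proof.
elim: k => [|k IH].
  by rewrite expn0 /erg_avg big_ord1/= invr1 scale1r.
by rewrite expnS mul2n -addnn (le_trans _ IH)// erg_avg_double_le// expn_gt0.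
Qed.

Lemma erg_avg_coboundary N h : erg_avg N (W h - h) = N%:R^-1 *: (iter N W h - h).
Proof.
congr (_ *: _); elim: N => [|N IH]; first by rewrite big_ord0/= subrr.
rewrite big_ord_recr/= IH.
have -> : iter N W (W h - h) = iter N.+1 W h - iter N W h.
  have [D Z _] := iter_isometry N.
  by rewrite -scaleN1r D Z scaleN1r -iterSr.
by rewrite addrC subrKA.
Qed.

Lemma ipnorm_erg_avg_coboundary N h :
  ipnorm ip (erg_avg N (W h - h)) <= N%:R^-1 * (2 * ipnorm ip h).
Proof.
rewrite erg_avg_coboundary (ipnormZ ipP) ger0_norm ?invr_ge0//.
rewrite ler_wpM2l ?invr_ge0//.
rewrite (le_trans (ler_ipnormB ipP _ _))//.
by rewrite /ipnorm; case: (iter_isometry N) => _ _ ->; lra.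
Qed.

(** Each [iter j W f - f] is the coboundary of the partial sum of the orbit up to [j]; the witness
    [h] is the mean of these partial sums. *)
Lemma erg_avg_sub_coboundary M f : (0 < M)%N ->
  exists h, erg_avg M f = f + (W h - h).
Proof.
move=> M0.
exists (M%:R^-1 *: \sum_(j < M) \sum_(i < j) iter i W f).
have hj j : W (\sum_(i < j) iter i W f) - \sum_(i < j) iter i W f = iter j W f - f.
  rewrite isometry_sum; elim: j => [|j IH]; first by rewrite !big_ord0/= !subrr.
  by rewrite !big_ord_recr/= opprD addrACA IH addrC subrKA.
rewrite WZ isometry_sum -scalerBr -sumrB.
under eq_bigr do rewrite hj.
rewrite sumrB scalerBr sumr_const card_ord -[f *+ M]scaler_nat scalerA mulVf ?scale1r.
  by rewrite addrC subrK.
by rewrite pnatr_eq0 -lt0n.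
Qed.

(* Averaging the midpoint [u] of two ergodic averages of [f] again gives, up to
   a coboundary, an ergodic average of [f], so [u] has norm at least the limit
   norm; the parallelogram law then yields the Cauchy property. *)
Lemma erg_avg_cauchy M N f c : (0 < M)%N -> (0 < N)%N -> 0 <= c ->
  (forall k, c <= ip (erg_avg (2 ^ k) f) (erg_avg (2 ^ k) f)) ->
  ip (erg_avg M f - erg_avg N f) (erg_avg M f - erg_avg N f)
    <= 2 * (ip (erg_avg M f) (erg_avg M f) - c) +
            2 * (ip (erg_avg N f) (erg_avg N f) - c).
Proof.
move=> M0 N0 c0 hc.
have [h hM] := erg_avg_sub_coboundary f M0.
have [h' hN] := erg_avg_sub_coboundary f N0.
set u := 2^-1 *: (erg_avg M f + erg_avg N f).
pose g := 2^-1 *: (h + h').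
have uE : u = f + (W g - g).
  rewrite /u hM hN /g WZ WD -scalerBr addrACA scalerDr -mulr2n -[f *+ 2]scaler_nat scalerA.
  by rewrite mulVf ?scale1r// ?pnatr_eq0// opprD [(W h + W h') + _]addrACA.
suff : c <= ip u u.
  by rewrite /u (ip_sqrZ ipP) (ip_sqrB ipP) (ip_sqrD ipP); lra.
rewrite -(sqr_ipnorm ipP) -(sqr_sqrtr c0) ler_pXn2r ?nnegrE ?sqrtr_ge0 ?ipnorm_ge0//.
apply/ler_addgt0Pl => e e0.
pose K := 2 * ipnorm ip g.
have K0 : 0 <= K by rewrite mulr_ge0 ?ipnorm_ge0.
(* With this length the average of the coboundary of [g] has norm at most [e], while averaging does
   not increase the norm of [u]. *)
have [k hk] : exists k : nat, K / e < (2 ^ k)%:R.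
  exists (Num.truncn (K / e)).+1.
  rewrite (lt_le_trans (truncnS_gt (K/e)))// ler_nat.
  exact/ltnW/ltn_expl.
set L := (2 ^ k)%N in hk.
have Lp : 0 < L%:R :> R by rewrite ltr0n expn_gt0.
have /le_trans : Num.sqrt c <= ipnorm ip (erg_avg L f).
  by rewrite /ipnorm ler_sqrt ?hc.
apply.
have -> : erg_avg L f = erg_avg L u - erg_avg L (W g - g).
  by rewrite uE [in RHS]erg_avgD addrK.
rewrite (le_trans (ler_ipnormB ipP _ _))// addrC lerD//.
  rewrite (le_trans (ipnorm_erg_avg_coboundary _ _))// mulrC ler_pdivrMr//.
  by move: hk; rewrite ltr_pdivrMr// mulrC => /ltW.
by rewrite /ipnorm ler_sqrt// erg_avg_pow2_le.
Qed.

Lemma ipnorm_erg_avg_invariant N f : (0 < N)%N ->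
  ipnorm ip (W (erg_avg N f) - erg_avg N f) <= N%:R^-1 * (2 * ipnorm ip f).
Proof.
move=> N0.
have -> : W (erg_avg N f) - erg_avg N f = erg_avg N (W f - f).
  rewrite /erg_avg WZ isometry_sum -scalerBr -sumrB; congr (_ *: _).
  apply: eq_bigr => i _; have [D Z _] := iter_isometry i.
  by rewrite -scaleN1r D Z scaleN1r -iterSr.
exact: ipnorm_erg_avg_coboundary.
Qed.

End mean_ergodic.

(** * Finite Fourier analysis and Dini *)

Section finite_fourier.
Context {R : realType}.
Implicit Types x y : R.

(** Dirichlet kernel: after multiplication by [2 sin y] each term is a difference of sines at
    consecutive odd multiples of [y], and the sum telescopes. *)
Lemma sin_sum_cos (m : nat) y :
  sin y *+ 2 * \sum_(k < m) cos (k%:R * (y *+ 2)) = sin (m%:R * (y *+ 2) - y) + sin y.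
Proof.
elim: m => [|m IH]; first by rewrite big_ord0 mulr0 mul0r sub0r sinN addNr.
rewrite big_ord_recr/= mulrDr IH -natr1.
have -> : (m%:R + 1) * (y *+ 2) - y = m%:R * (y *+ 2) + y by rewrite mulrDl mul1r; ring.
by rewrite sinB sinD; ring.
Qed.

Lemma sum_cos_roots_of_unity (M a b : nat) : (a < M)%N -> (b < M)%N ->
  \sum_(k < M) cos ((a%:R - b%:R) * (2 * pi * k%:R / M%:R)) =
  (if a == b then M%:R else 0) :> R.
Proof.
wlog ba : a b / (b <= a)%N => [hw aM bM|aM bM].
  have [ba|/ltnW ab] := leqP b a; first exact: hw.
  rewrite eq_sym -hw//; apply: eq_bigr => k _.
  by rewrite -cosN -mulNr opprB.
have [->|ab] := eqVneq.
  by under eq_bigr do rewrite subrr mul0r cos0; rewrite sumr_const card_ord.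
have M0 : 0 < M%:R :> R by rewrite ltr0n (leq_ltn_trans _ aM).
pose n := (a - b)%N.
have n0 : (0 < n)%N by rewrite /n subn_gt0 ltn_neqAle eq_sym ab.
(* Half the angle between consecutive terms. Since [0 < n < M] its sine is nonzero, and the closed
   form ends at [- y] plus a multiple of [2 pi], so the sum is zero. *)
pose y : R := pi * n%:R / M%:R.
have y0 : 0 < y < pi.
  apply/andP; split; first by rewrite /y divr_gt0// mulr_gt0 ?pi_gt0// ltr0n.
  rewrite /y ltr_pdivrMr//.
  by rewrite ltr_pM2l ?pi_gt0// ltr_nat (leq_ltn_trans _ aM)// leq_subr.
have sy : sin y != 0 by rewrite gt_eqF// sin_gt0_pi.
have E k : (a%:R - b%:R) * (2 * pi * k%:R / M%:R) = k%:R * (y *+ 2).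
  by rewrite /y -natrB// -/n -mulr_natr; ring.
under eq_bigr do rewrite E.
apply: (mulfI (x := sin y *+ 2)); first by rewrite mulrn_eq0.
rewrite sin_sum_cos mulr0.
have -> : M%:R * (y *+ 2) - y = - y + (pi *+ 2) *+ n.
  rewrite /y -(mulr_natr (pi *+ 2)) addrC; congr (_ + _).
  by rewrite -mulr_natr -[pi *+ 2]mulr_natr; field; rewrite gt_eqF.
by rewrite (periodicn (@sinD2pi R)) sinN addNr.
Qed.

Lemma card_diagonal (L d : nat) : (\sum_(l < L) (l + d < L))%N = (L - d)%N.
Proof.
elim: L => [|L IH]; first by rewrite big_ord0.
rewrite big_ord_recl/= add0n.
under eq_bigr do rewrite /bump/= add1n addSn ltnS.
by rewrite IH; lia.
Qed.

Lemma sum_indicator (L m : nat) : \sum_(l < L) ((l : nat) == m)%:R = (m < L)%:R :> R.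
Proof.
have [mL|mL] := ltnP m L; last first.
  rewrite big1// => l _; case: eqP => // lm.
  by have := ltn_ord l; rewrite lm ltnNge mL.
rewrite (bigD1 (Ordinal mL))//= eqxx big1 ?addr0// => l lm.
by rewrite (negbTE (_ : (l : nat) != m))//; apply: contra lm => /eqP lm; apply/eqP/val_inj.
Qed.

(** One of the two truncated subtractions is zero, so this is the Fejer weight: [L] minus the
    distance of [j] and [j'], cut off at 0. *)
Lemma card_diagonal_pairs (L j j' : nat) :
  \sum_(p : 'I_L * 'I_L) (j + p.1 == j' + p.2)%N%:R = (L - (j - j') - (j' - j))%N%:R :> R.
Proof.
wlog jj : j j' / (j' <= j)%N => [hw|].
  have [ba|/ltnW ab] := leqP j' j; first exact: hw.
  rewrite subnAC -hw//.
  rewrite -!(pair_bigA _ (fun x y : 'I_L => (_ + x == _ + y)%N%:R))/= exchange_big/=.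
  by apply: eq_bigr => i _; apply: eq_bigr => k _; rewrite eq_sym.
have -> : (j' - j = 0)%N by lia.
rewrite subn0 -card_diagonal natr_sum.
rewrite -(pair_bigA _ (fun x y : 'I_L => (j + x == j' + y)%N%:R))/=.
apply: eq_bigr => i _; rewrite -sum_indicator; apply: eq_bigr => k _.
by congr (_%:R); congr nat_of_bool; lia.
Qed.

Lemma le_card_diagonal_pairs (L N j j' : nat) : (j < N)%N -> (j' < N)%N ->
  `|\sum_(p : 'I_L * 'I_L) (j + p.1 == j' + p.2)%N%:R - L%:R| <= N%:R :> R.
Proof.
move=> jN jN'; rewrite card_diagonal_pairs distrC ger0_norm.
  by rewrite -natrB ?ler_nat; lia.
by rewrite subr_ge0 ler_nat; lia.
Qed.

(* Von Neumann's inequality for an isometry: testing against the Fejer-type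
   weights [G], summed over the [N + L]-th roots of unity, recovers the Toeplitz
   form up to an error [O(1 / L)]. *)
Lemma toeplitz_form_le (phi : nat -> nat -> R) (N : nat) (c : nat -> R) (P : R) :
  (forall i j, phi i j = phi j i) ->
  (forall i j m, phi (i + m)%N (j + m)%N = phi i j) ->
  (forall L x, 0 <= \sum_(p : 'I_L * 'I_L) cos ((p.1%:R - p.2%:R) * x) * phi p.1 p.2) ->
  (forall x, 0 <= x <= 2 * pi ->
     \sum_(p : 'I_N * 'I_N) c p.1 * c p.2 * cos ((p.1%:R - p.2%:R) * x) <= P) ->
  \sum_(p : 'I_N * 'I_N) c p.1 * c p.2 * phi p.1 p.2 <= P * phi 0%N 0%N.
Proof.
move=> phiC phiT phi_ge0 hP.
pose E x := \sum_(p : 'I_N * 'I_N) c p.1 * c p.2 * cos ((p.1%:R - p.2%:R) * x).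
(* The sine counterpart of [E] is zero because exchanging the indices changes its sign. Subtracting
   a product with it turns [E x * G L x] into a sum of cosines of added angles. *)
pose E' x := \sum_(p : 'I_N * 'I_N) c p.1 * c p.2 * sin ((p.1%:R - p.2%:R) * x).
have E'0 x : E' x = 0.
  suff : E' x = - E' x by lra.
  rewrite {1}/E' -(pair_bigA _ (fun i j : 'I_N => c i * c j * sin ((i%:R - j%:R) * x)))/=.
  rewrite exchange_big/= pair_bigA/= /E' -sumrN; apply: eq_bigr => p _.
  by rewrite -(opprB p.1%:R) mulNr sinN; ring.
pose G L x := \sum_(p : 'I_L * 'I_L) cos ((p.1%:R - p.2%:R) * x) * phi p.1 p.2.
pose C := \sum_(p : 'I_N * 'I_N) `|c p.1 * c p.2 * phi p.1 p.2| * N%:R.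
have C0 : 0 <= C by apply: sumr_ge0 => p _; rewrite mulr_ge0.
set Q := (X in X <= _).
(* The error [C] does not depend on [L], so dividing by a large [L] removes it. *)
suff key L : (0 < L)%N -> Q * L%:R <= P * phi 0%N 0%N * L%:R + C.
  apply/ler_addgt0Pr => e e0.
  pose L := (Num.truncn (C / e)).+1.
  have Lp : 0 < L%:R :> R by rewrite ltr0n.
  rewrite -(ler_pM2r Lp) mulrDl; apply: le_trans (key L (ltn0Sn _)) _.
  rewrite lerD2l mulrC -ler_pdivrMr//.
  exact/ltW/truncnS_gt.
move=> L0.
(* All indices [p.1 + r.1] and [p.2 + r.2] stay below [M], so summing over the [M]-th roots of unity
   keeps exactly the pairs with equal sums. *)
pose M := (N + L)%N.
have M0 : 0 < M%:R :> R by rewrite ltr0n /M addn_gt0 L0 orbT.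
pose t (k : nat) : R := 2 * pi * k%:R / M%:R.
have tP (k : 'I_M) : 0 <= t k <= 2 * pi.
  have p0 := pi_ge0 R.
  apply/andP; split; first by rewrite /t divr_ge0 ?mulr_ge0.
  rewrite /t ler_pdivrMr// ler_wpM2l ?mulr_ge0// ler_nat.
  exact/ltnW.
have EG x : E x * G L x = \sum_(p : 'I_N * 'I_N) \sum_(r : 'I_L * 'I_L)
    c p.1 * c p.2 * phi r.1 r.2 * cos (((p.1 + r.1)%:R - (p.2 + r.2)%:R) * x).
  transitivity (E x * G L x - E' x *
      \sum_(p : 'I_L * 'I_L) sin ((p.1%:R - p.2%:R) * x) * phi p.1 p.2).
    by rewrite E'0 mul0r subr0.
  rewrite /E /G /E' !big_distrlr/= -sumrB; apply: eq_bigr => p _.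
  rewrite -sumrB; apply: eq_bigr => r _.
  have -> : ((p.1 + r.1)%:R - (p.2 + r.2)%:R) * x =
      (p.1%:R - p.2%:R) * x + (r.1%:R - r.2%:R) * x by rewrite !natrD; ring.
  by rewrite cosD; ring.
have SG : \sum_(k < M) G L (t k) = M%:R * (L%:R * phi 0%N 0%N).
  rewrite /G exchange_big/=.
  transitivity (\sum_(p : 'I_L * 'I_L) (M%:R * phi 0%N 0%N) * (0 + p.1 == 0 + p.2)%N%:R).
    apply: eq_bigr => p _; rewrite -mulr_suml sum_cos_roots_of_unity.
    - rewrite !add0n; case: eqP => [->|_]; last by rewrite mul0r mulr0.
      by rewrite mulr1 -[X in phi X X]add0n phiT.
    - by rewrite /M ltn_addl.
    - by rewrite /M ltn_addl.
  by rewrite -mulr_sumr card_diagonal_pairs !subn0; ring.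
have SEG : \sum_(k < M) E (t k) * G L (t k) =
    M%:R * \sum_(p : 'I_N * 'I_N) c p.1 * c p.2 * phi p.1 p.2 *
      \sum_(r : 'I_L * 'I_L) (p.1 + r.1 == p.2 + r.2)%N%:R.
  under eq_bigr do rewrite EG.
  rewrite exchange_big/= mulr_sumr; apply: eq_bigr => p _.
  rewrite exchange_big/= mulrA mulr_sumr; apply: eq_bigr => r _.
  rewrite -mulr_sumr sum_cos_roots_of_unity.
  - case: eqP => [e|_]; last by rewrite !mulr0.
    suff -> : phi r.1 r.2 = phi p.1 p.2 by rewrite mulr1; ring.
    rewrite -(phiT r.1 r.2 p.2) [(r.2 + _)%N]addnC -e [(p.1 + _)%N]addnC.
    by rewrite [(r.1 + _)%N]addnC [(r.1 + _)%N]addnC phiT phiC.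
  - by rewrite /M -addnS leq_add// ltnW.
  - by rewrite /M -addnS leq_add// ltnW.
(* Positivity of the weights [G L (t k)] is what allows [E] to be replaced by its bound [P] under
   the sum. *)
have le1 : \sum_(k < M) E (t k) * G L (t k) <= P * (M%:R * (L%:R * phi 0%N 0%N)).
  rewrite -SG mulr_sumr ler_sum// => k _.
  by rewrite ler_wpM2r ?phi_ge0// hP.
move: le1; rewrite SEG mulrCA ler_pM2l// => le1.
rewrite -lerBlDr -[X in _ <= X]mulrA [phi _ _ * _]mulrC.
apply: le_trans le1.
rewrite /Q mulr_suml -sumrB ler_sum// => p _.
rewrite lerBlDr -lerBlDl -mulrBr.
apply: (le_trans (ler_norm _)); rewrite normrM ler_wpM2l//.
by rewrite distrC le_card_diagonal_pairs.
Qed.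

End finite_fourier.

(** Otherwise there are points [u k] with [S k (u k) >= e], clustering at some [x]. Some [S k] is
    below [e] near [x], and monotonicity passes this to [S m (u m)] for some [m >= k], a
    contradiction. *)
Lemma antitone_dini (R : realType) (a b : R) (S : nat -> R -> R) :
  (forall k, continuous (S k)) -> (forall k x, S k.+1 x <= S k x) ->
  (forall x (e : R), 0 < e -> exists k, S k x < e) ->
  forall e : R, 0 < e -> exists k, forall x, a <= x <= b -> S k x < e.
Proof.
move=> Sc Sd S0 e e0; apply: contrapT => /forallNP hn.
have Sle k m x : (k <= m)%N -> S m x <= S k x.
  elim: m => [|m IH]; first by rewrite leqn0 => /eqP ->.
  rewrite leq_eqVlt => /predU1P[->//|/IH]; exact: le_trans.
have /choice[u uP] : forall k, exists x, a <= x <= b /\ e <= S k x.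
  move=> k; have /existsNP[x /not_implyP[ab /negP]] := hn k.
  by rewrite -leNgt => ex; exists x.
have [|x [_ xcl]] := @segment_compact R a b (u @ \oo) _.
  by exists 0%N => // k _ /=; rewrite in_itv/=; case: (uP k).
have [k Sk] := S0 x e e0.
have A1 : (u @ \oo) (u @` [set m | (k <= m)%N]) by exists k => // m km; exists m.
have A2 : nbhs x [set y | S k y < e].
  exact: (cvgr_lt _ (Sc k x) _ Sk).
have [_ [[m km <-] Skm]] := xcl _ _ A1 A2.
have [_ em] := uP m.
by have := lt_le_trans Skm (le_trans em (Sle _ _ _ km)); rewrite ltxx.
Qed.

(** * Decay of correlations *)

Lemma le_sum_ord_nat (R : realType) (a : nat -> R) (m n : nat) :
  (forall j, 0 <= a j) -> (m <= n)%N -> \sum_(j < m) a j <= \sum_(j < n) a j.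
Proof.
move=> a0 mn; rewrite -(subnKC mn) big_split_ord/= lerDl.
by apply: sumr_ge0.
Qed.

(** Enlarging the sum from [n] terms to the next power of two costs at most a factor 2, as the terms
    are nonnegative. *)
Lemma cesaro_cvg0_pow2 (R : realType) (a : nat -> R) :
  (forall j, 0 <= a j) ->
  (forall e : R, 0 < e -> exists k0 : nat, forall k, (k0 <= k)%N ->
     (2 ^ k)%N%:R^-1 * \sum_(j < 2 ^ k) a j < e) ->
  (fun n : nat => n%:R^-1 * \sum_(j < n) a j) @ \oo --> (0 : R).
Proof.
move=> a0 ha; apply/cvgrPdist_lt => e e0.
have e2 : 0 < e / 2 by rewrite divr_gt0.
have [k0 hk] := ha _ e2.
exists (2 ^ k0)%N => // n /= nk; rewrite sub0r normrN.
rewrite ger0_norm ?mulr_ge0 ?invr_ge0 ?sumr_ge0//.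
have n0 : (0 < n)%N by rewrite (leq_trans _ nk)// expn_gt0.
have /andP[kn nkS] := trunc_log_bounds (isT : (1 < 2)%N) n0.
set k := trunc_log 2 n in kn nkS.
have k0k : (k0 <= k.+1)%N.
  by apply/ltnW; rewrite -(ltn_exp2l _ _ (isT : (1 < 2)%N)) (leq_ltn_trans nk).
have := hk _ k0k; set S := \sum_(j < 2 ^ k.+1) a j => hS.
have S0 : 0 <= S by rewrite sumr_ge0.
apply: (@le_lt_trans _ _ (n%:R^-1 * S)).
  by rewrite ler_wpM2l ?invr_ge0// le_sum_ord_nat// ltnW.
have np : 0 < n%:R :> R by rewrite ltr0n.
rewrite mulrC ltr_pdivrMr//.
move: hS; rewrite mulrC ltr_pdivrMr ?ltr0n ?expn_gt0// => /lt_le_trans; apply.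
rewrite expnS natrM mulrA divfK ?pnatr_eq0// ler_pM2l// ler_nat.
exact: kn.
Qed.

(** The variance of the values [|a j|] about their mean [m] is nonnegative. *)
Lemma sqr_mean_le (R : realType) (N : nat) (a : nat -> R) :
  (N%:R^-1 * \sum_(j < N) `|a j|) ^+ 2 <= N%:R^-1 * \sum_(j < N) a j ^+ 2.
Proof.
have [->|N0] := posnP N; first by rewrite invr0 !mul0r expr0n.
have Np : 0 < N%:R :> R by rewrite ltr0n.
set m := _ * _.
have : 0 <= \sum_(j < N) (`|a j| - m) ^+ 2 by rewrite sumr_ge0// => j _; exact: sqr_ge0.
under eq_bigr do rewrite sqrrB real_normK ?num_real// -mulrnAl.
rewrite big_split/= sumrB sumr_const card_ord -mulr_suml.
under [X in _ - X * _ + _]eq_bigr do rewrite -mulr_natr.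
rewrite -mulr_suml.
have -> : \sum_(j < N) `|a j| = N%:R * m by rewrite /m mulVKf// gt_eqF.
rewrite [N%:R^-1 * _]mulrC ler_pdivlMr// -(mulr_natr (m ^+ 2)).
by set s := \sum_(j < N) _; lra.
Qed.

(** * Isometries twisted by a phase, and their spectral averages *)

Section rotation_extension.
Context (R : realType) (V : lmodType R) (ip : V -> V -> R) (ipP : semi_inner ip).
Context (U : V -> V) (UP : linear_isometry ip U).
Implicit Types (f h : V) (x : R).

(** With a complex function stored as its real and imaginary parts, this is the real part of the
    Hermitian product. *)
Definition ip_pair (a b : V * V) := ip a.1 b.1 + ip a.2 b.2.

Lemma ip_pair_semi_inner : semi_inner ip_pair.
Proof.
have [C D Z P] := ipP; split=> [a b|a b c|t a b|a]; rewrite /ip_pair/=.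
- by rewrite C (C a.2).
- by rewrite !D addrACA.
- by rewrite !Z mulrDr.
- by rewrite addr_ge0.
Qed.

(* The isometry [z |-> e^(i x) (z o T)], a complex function being a pair. *)
Definition rot x (a : V * V) : V * V :=
  (cos x *: U a.1 - sin x *: U a.2, sin x *: U a.1 + cos x *: U a.2).

Lemma rot_isometry x : linear_isometry ip_pair (rot x).
Proof.
have [UD UZ UI] := UP; have [C D Z P] := ipP.
split=> [a b|t a|a b]; rewrite /rot/=.
- congr pair; rewrite !UD !scalerDr ?opprD.
    by rewrite addrACA.
  by rewrite addrACA.
- by congr pair; rewrite /= !UZ ?scalerDr ?scalerN !scalerA ![t * _]mulrC.
- rewrite /ip_pair/= -!scaleNr !(D, Z, ipDr ipP, ipZr ipP) !UI.
  have := cos2Dsin2 x; set c := cos x; set s := sin x => cs.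
  transitivity ((c ^+ 2 + s ^+ 2) * (ip a.1 b.1 + ip a.2 b.2)); first by ring.
  by rewrite cs mul1r.
Qed.

Lemma iter_rot x f j :
  iter j (rot x) (f, 0) = (cos (j%:R * x) *: iter j U f, sin (j%:R * x) *: iter j U f).
Proof.
have [UD UZ UI] := UP.
elim: j => [|j IH]; first by rewrite mul0r cos0 sin0 scale1r scale0r.
rewrite iterS IH /rot/= !UZ !scalerA -scalerBl -scalerDl -natr1 mulrDl mul1r.
by rewrite cosD sinD; congr pair; congr (_ *: _); ring.
Qed.

Lemma trig_sum_norm (u : nat -> V) N x :
  let c := \sum_(i < N) cos (i%:R * x) *: u i in
  let s := \sum_(i < N) sin (i%:R * x) *: u i in
  ip c c + ip s s =
  \sum_(p : 'I_N * 'I_N) cos ((p.1%:R - p.2%:R) * x) * ip (u p.1) (u p.2).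
Proof.
have [C D Z P] := ipP.
rewrite /= -(pair_bigA _ (fun i j : 'I_N => cos ((i%:R - j%:R) * x) * ip (u i) (u j)))/=.
rewrite !(ip_suml ipP) -big_split/=; apply: eq_bigr => i _.
rewrite !(ip_sumr ipP) -big_split/=; apply: eq_bigr => j _.
by rewrite mulrBl cosB !(Z, ipZr ipP); ring.
Qed.

Definition spectral_avg f N x :=
  ip_pair (erg_avg (rot x) N (f, 0)) (erg_avg (rot x) N (f, 0)).

Lemma erg_avg_rotE f N x : erg_avg (rot x) N (f, 0) =
  (N%:R^-1 *: \sum_(i < N) cos (i%:R * x) *: iter i U f,
   N%:R^-1 *: \sum_(i < N) sin (i%:R * x) *: iter i U f).
Proof.
rewrite /erg_avg; under eq_bigr do rewrite iter_rot.
have -> : \sum_(i < N) (cos (i%:R * x) *: iter i U f, sin (i%:R * x) *: iter i U f) =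
  (\sum_(i < N) cos (i%:R * x) *: iter i U f, \sum_(i < N) sin (i%:R * x) *: iter i U f).
  by elim/big_rec3: _ => //= i a b c _ ->.
by [].
Qed.

Lemma spectral_avgE f N x : spectral_avg f N x = N%:R^-1 ^+ 2 *
  \sum_(p : 'I_N * 'I_N) cos ((p.1%:R - p.2%:R) * x) * ip (iter p.1 U f) (iter p.2 U f).
Proof.
rewrite /spectral_avg erg_avg_rotE /ip_pair/= !(ip_sqrZ ipP) -mulrDr.
by rewrite (trig_sum_norm (fun i => iter i U f)).
Qed.

(** The mean of the squared correlations [psi j] is [ip v h] with [v] the mean of the
    [psi j *: iter j U f]. The norm of [v] is a Toeplitz form, bounded by the supremum of the
    squared modulus of the trigonometric polynomial with coefficients [psi j]. That polynomial is
    itself a product of [h] with a twisted orbit sum, so Cauchy-Schwarz bounds it by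
    [spectral_avg]. *)
Lemma correlation_sqr_avg_le f h N e : (0 < N)%N ->
  (forall x, 0 <= x <= 2 * pi -> spectral_avg f N x <= e) ->
  (N%:R^-1 * \sum_(j < N) ip (iter j U f) h ^+ 2) ^+ 2 <= ip h h ^+ 2 * ip f f * e.
Proof.
move=> N0 hS; have [C D Z P] := ipP.
have Np : 0 < N%:R :> R by rewrite ltr0n.
pose psi j := ip (iter j U f) h.
pose phi i j := ip (iter i U f) (iter j U f).
pose v := N%:R^-1 *: \sum_(j < N) psi j *: iter j U f.
have -> : N%:R^-1 * \sum_(j < N) ip (iter j U f) h ^+ 2 = ip v h.
  rewrite /v Z (ip_suml ipP); congr (_ * _); apply: eq_bigr => j _.
  by rewrite Z expr2.
apply: le_trans (cauchy_schwarz ipP _ _) _.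
suff : ip v v <= ip h h * ip f f * e.
  by move=> /(ler_wpM2r (P h)) /le_trans; apply; rewrite expr2 le_eqVlt; apply/orP; left;
     apply/eqP; ring.
have -> : ip v v = N%:R^-1 ^+ 2 *
    \sum_(p : 'I_N * 'I_N) psi p.1 * psi p.2 * phi p.1 p.2.
  rewrite /v (ip_sqrZ ipP) -(pair_bigA _ (fun i j : 'I_N => psi i * psi j * phi i j))/=.
  congr (_ * _); rewrite (ip_suml ipP); apply: eq_bigr => i _.
  rewrite (ip_sumr ipP); apply: eq_bigr => j _.
  by rewrite Z (ipZr ipP) mulrA.
have -> : ip h h * ip f f * e = N%:R^-1 ^+ 2 * (ip h h * (N%:R ^+ 2 * e) * phi 0%N 0%N).
  by rewrite /phi/=; field; rewrite gt_eqF.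
rewrite ler_wpM2l ?sqr_ge0//.
apply: toeplitz_form_le => [i j|i j m|L x|x x0].
- by rewrite /phi C.
- rewrite /phi addnC iterD [(j + m)%N]addnC iterD.
  by case: (iter_isometry UP m).
- by rewrite /phi -(trig_sum_norm (fun i => iter i U f)) addr_ge0.
pose c := \sum_(i < N) cos (i%:R * x) *: iter i U f.
pose s := \sum_(i < N) sin (i%:R * x) *: iter i U f.
have -> : \sum_(p : 'I_N * 'I_N) psi p.1 * psi p.2 * cos ((p.1%:R - p.2%:R) * x) =
    ip c h ^+ 2 + ip s h ^+ 2.
  rewrite -(pair_bigA _ (fun i j : 'I_N => psi i * psi j * cos ((i%:R - j%:R) * x)))/=.
  rewrite /c /s !(ip_suml ipP) !expr2 !big_distrlr/= -big_split/=.
  apply: eq_bigr => i _; rewrite -big_split/=; apply: eq_bigr => j _.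
  by rewrite mulrBl cosB !Z /psi; ring.
have : N%:R ^+ 2 * spectral_avg f N x <= N%:R ^+ 2 * e by rewrite ler_wpM2l ?sqr_ge0// hS.
rewrite spectral_avgE -(trig_sum_norm (fun i => iter i U f)) -/c -/s.
rewrite mulrA -exprMn divff ?gt_eqF// expr1n mul1r => /(ler_wpM2l (P h)).
apply: le_trans; rewrite mulrDr lerD//.
  by rewrite mulrC cauchy_schwarz.
by rewrite mulrC cauchy_schwarz.
Qed.

Lemma spectral_avg_pow2_antitone f k x :
  spectral_avg f (2 ^ k.+1) x <= spectral_avg f (2 ^ k) x.
Proof.
rewrite /spectral_avg expnS mul2n -addnn.
by apply: (erg_avg_double_le ip_pair_semi_inner (rot_isometry x)); rewrite expn_gt0.
Qed.

Lemma spectral_avg_continuous f N : continuous (spectral_avg f N).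
Proof.
move=> x.
have -> : spectral_avg f N = (fun x => N%:R^-1 ^+ 2 * \sum_(p : 'I_N * 'I_N)
    cos ((p.1%:R - p.2%:R) * x) * ip (iter p.1 U f) (iter p.2 U f)).
  by apply/funext => y; exact: spectral_avgE.
apply: cvgMl_tmp; apply: cvg_big => [|p _]; first exact: add_continuous.
apply: cvgMr_tmp; apply: (continuous_comp _ (@continuous_cos R _)).
by apply: cvgMl_tmp; exact: cvg_id.
Qed.

Lemma correlation_cesaro_cvg0 f h :
  (forall x (e : R), 0 < e -> exists k, spectral_avg f (2 ^ k) x < e) ->
  (fun n : nat => n%:R^-1 * \sum_(j < n) `|ip (iter j U f) h|) @ \oo --> (0 : R).
Proof.
move=> hf; apply: (@cesaro_cvg0_pow2 R (fun j => `|ip (iter j U f) h|)) => // e e0.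
have [_ _ _ P] := ipP.
pose K := ip h h ^+ 2 * ip f f + 1.
have K0 : 0 < K by rewrite ltr_pwDr// mulr_ge0 ?sqr_ge0.
(* The mean of the absolute correlations, raised to the fourth power, is at most
   [ip h h ^+ 2 * ip f f * d]; the 1 added in [K] makes it positive. *)
pose d := e ^+ 4 / K.
have d0 : 0 < d by rewrite divr_gt0 ?exprn_gt0.
have [k0 hk0] := @antitone_dini R 0 (2 * pi) (fun k => spectral_avg f (2 ^ k))
  (fun k => @spectral_avg_continuous f (2 ^ k)) (spectral_avg_pow2_antitone f) hf d d0.
exists k0 => k k0k.
have hk x : 0 <= x <= 2 * pi -> spectral_avg f (2 ^ k) x <= d.
  move=> /hk0 /ltW; apply: le_trans.
  elim: k k0k => [|k IH]; first by rewrite leqn0 => /eqP ->.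
  rewrite leq_eqVlt => /predU1P[<-//|/IH]; apply: le_trans.
  exact: spectral_avg_pow2_antitone.
have N0 : (0 < 2 ^ k)%N by rewrite expn_gt0.
have := correlation_sqr_avg_le h N0 hk.
have := sqr_mean_le (2 ^ k) (fun j => ip (iter j U f) h).
set m := _ * \sum_(j < _) `|_|; set s := _ * \sum_(j < _) _ ^+ 2 => ms sd.
have m0 : 0 <= m by rewrite mulr_ge0 ?invr_ge0 ?sumr_ge0.
rewrite -(@ltr_pXn2r _ 4)// ?nnegrE ?(ltW e0)//.
have m4 : m ^+ 4 <= s ^+ 2.
  have -> : m ^+ 4 = (m ^+ 2) ^+ 2 by rewrite -exprM.
  by rewrite ler_pXn2r// nnegrE ?sqr_ge0// (le_trans _ ms) ?sqr_ge0.
apply: (le_lt_trans (le_trans m4 sd)).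
rewrite /d mulrA ltr_pdivrMr// [_ * K]mulrC ltr_pM2r ?exprn_gt0//.
by rewrite /K ltrDl.
Qed.

End rotation_extension.

(** * Bounded measurable functions and the Koopman operator *)

Section bounded_measurable.
Context d (X : measurableType d) (R : realType).

Definition bounded_measurable : {pred X -> R} :=
  [pred f : X -> R | `[< measurable_fun setT f /\ exists M, forall x, `|f x| <= M >]].

Lemma bounded_measurableP (f : X -> R) : reflect
  (measurable_fun setT f /\ exists M, forall x, `|f x| <= M) (f \in bounded_measurable).
Proof. by rewrite inE; exact: asboolP. Qed.

Lemma bounded_measurable_submod_closed : submod_closed bounded_measurable.
Proof.
split.
  apply/bounded_measurableP; split; first exact: measurable_cst.
  by exists 0 => x; rewrite normr0.
move=> a f g /bounded_measurableP[mf [M fM]] /bounded_measurableP[mg [N gN]].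
apply/bounded_measurableP; split.
  apply: measurable_funD => //.
  by apply: measurable_funM => //; exact: measurable_cst.
exists (`|a| * M + N) => x; rewrite (le_trans (ler_normD _ _))// lerD//.
by rewrite normrM ler_wpM2l.
Qed.

HB.instance Definition _ := GRing.isSubmodClosed.Build _ _ bounded_measurable
  bounded_measurable_submod_closed.

(** Functions, not classes modulo null sets: they form a vector space on which averages and iterates
    of [T] can be evaluated pointwise, and boundedness makes all products integrable. *)
Record bmfun := Bmfun { bmfun_val :> X -> R ; bmfunP : bmfun_val \in bounded_measurable }.

HB.instance Definition _ := [isSub for bmfun_val].
HB.instance Definition _ := [Choice of bmfun by <:].
HB.instance Definition _ := [SubChoice_isSubLmodule of bmfun by <:].

Lemma bmfunD (f g : bmfun) x : (f + g) x = f x + g x. Proof. by []. Qed.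
Lemma bmfunZ a (f : bmfun) x : (a *: f) x = a * f x. Proof. by []. Qed.
End bounded_measurable.

Section koopman.
Context d (X : measurableType d) (R : realType) (mu : probability X R).
Implicit Types f g : X -> R.
Local Notation BM := (@bounded_measurable d X R).

Lemma bounded_measurable_integrable f : f \in BM -> mu.-integrable setT (EFin \o f).
Proof.
move=> /bounded_measurableP[mf [M fM]].
apply: measurable_bounded_integrable => //; first by rewrite -ge0_fin_numE ?fin_num_measure.
by exists M; split; [exact: num_real|move=> N MN x _; rewrite /= (le_trans (fM x))// ltW].
Qed.

Lemma bounded_measurableM f g : f \in BM -> g \in BM -> (fun x => f x * g x) \in BM.
Proof.
move=> /bounded_measurableP[mf [M fM]] /bounded_measurableP[mg [N gN]].
apply/bounded_measurableP; split; first exact: measurable_funM.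
by exists (M * N) => x; rewrite normrM ler_pM.
Qed.

Lemma bounded_measurable_cst c : (fun=> c) \in BM.
Proof. by apply/bounded_measurableP; split; [exact: measurable_cst|exists `|c|]. Qed.

Lemma bounded_measurable_norm f : f \in BM -> (fun x => `|f x|) \in BM.
Proof.
move=> /bounded_measurableP[mf [M fM]]; apply/bounded_measurableP; split.
  exact: measurableT_comp.
by exists M => x; rewrite normr_id.
Qed.

Definition l2ip (f g : bmfun X R) : R := \int[mu]_x (f x * g x).

Lemma l2ip_semi_inner : semi_inner l2ip.
Proof.
have iM (f g : bmfun X R) : mu.-integrable setT (EFin \o (fun x => f x * g x)).
  exact/bounded_measurable_integrable/bounded_measurableM/bmfunP/bmfunP.
split=> [f g|f g h|a f g|f]; rewrite /l2ip.
- by apply: eq_Rintegral => x _; rewrite mulrC.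
- rewrite -RintegralD//; apply: eq_Rintegral => x _.
  by rewrite bmfunD mulrDl.
- rewrite -RintegralZl//; apply: eq_Rintegral => x _.
  by rewrite bmfunZ mulrA.
- by apply: Rintegral_ge0 => x _; rewrite -expr2 sqr_ge0.
Qed.

Context (T : X -> X) (TP : measure_preserving mu T).

Lemma bounded_measurable_comp f : f \in BM -> f \o T \in BM.
Proof.
move=> /bounded_measurableP[mf [M fM]]; apply/bounded_measurableP; split.
  by apply: measurableT_comp => //; case: TP.
by exists M => x; exact: fM.
Qed.

Lemma Rintegral_comp f : f \in BM -> \int[mu]_x f (T x) = \int[mu]_x f x.
Proof.
move=> fb; have [mT Tmu] := TP.
have [mf _] := bounded_measurableP _ fb.
have /integral_pushforward E : mu.-integrable (T @^-1` setT) ((EFin \o f) \o T).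
  exact: (bounded_measurable_integrable (bounded_measurable_comp fb)).
have mEf : measurable_fun setT (EFin \o f) by exact/measurable_EFinP.
rewrite /Rintegral; congr fine.
rewrite -[LHS](E mT mEf measurableT).
by apply: eq_measure_integral => A mA _; exact: Tmu.
Qed.

Definition koopman (f : bmfun X R) : bmfun X R := Bmfun (bounded_measurable_comp (bmfunP f)).

Lemma koopman_isometry : linear_isometry l2ip koopman.
Proof.
split=> [f g|a f|f g]; [exact/val_inj|exact/val_inj|].
rewrite /l2ip (@Rintegral_comp (fun x => f x * g x))//.
exact/bounded_measurableM/bmfunP/bmfunP.
Qed.

Lemma iter_koopman n (f : bmfun X R) x : iter n koopman f x = f (iter n T x).
Proof. by elim: n x => // n IH x; rewrite /= IH -iterSr. Qed.

Lemma bmfun_sum (I : Type) (s : seq I) (F : I -> bmfun X R) x :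
  (\sum_(i <- s) F i) x = \sum_(i <- s) F i x.
Proof. by elim/big_rec2: _ => // i a b _ <-. Qed.

End koopman.

(** * Null sets, invariant sets and almost everywhere convergence *)

Section ae_dynamics.
Context d (X : measurableType d) (R : realType) (mu : probability X R).

Lemma ae_measure_eq (A B : set X) : measurable A -> measurable B ->
  {ae mu, forall x, A x <-> B x} -> mu A = mu B.
Proof.
move=> mA mB [N [mN N0 hN]].
have E C : measurable C -> mu C = mu (C `\` N).
  move=> mC; rewrite (@measureDI _ _ _ mu C N)//.
  rewrite [X in _ + X](@subset_measure0 _ _ _ mu (C `&` N) N) ?adde0//.
  exact: measurableI.
rewrite E// [RHS]E//; congr (mu _); apply/seteqP.
by split=> x [Ax Nx]; split=> //; apply: contrapT => Bx; apply: Nx; apply: hN => /=;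
  rewrite -[_ <-> _]/(_ /\ _) => -[h1 h2]; tauto.
Qed.

Lemma ae_measure0 (A : set X) : measurable A -> mu A = 0%E -> {ae mu, forall x, ~ A x}.
Proof. by move=> mA A0; exists A; split=> // x /= /contrapT. Qed.

Lemma measure1_ae (A : set X) : measurable A -> mu A = 1%E -> {ae mu, forall x, A x}.
Proof.
move=> mA A1; exists (~` A); split=> //; first exact: measurableC.
by rewrite probability_setC// A1 subee.
Qed.

Context (T : X -> X) (TP : measure_preserving mu T).

Lemma iter_measure_preserving n : measure_preserving mu (iter n T).
Proof.
have [mT Tmu] := TP.
elim: n => [|n [mTn IH]]; first by split; [exact: measurable_id|].
split=> [|A mA]; first exact: measurableT_comp.
rewrite -[LHS]/(mu (iter n T @^-1` (T @^-1` A))) IH ?Tmu//.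
by rewrite -[X in measurable X]setTI; exact: mT.
Qed.

Lemma measurable_preimage_iter n (A : set X) : measurable A ->
  measurable (iter n T @^-1` A).
Proof.
by have [mT _] := iter_measure_preserving n => mA; rewrite -[X in measurable X]setTI; exact: mT.
Qed.

Lemma ae_iter (P : X -> Prop) : {ae mu, forall x, P x} ->
  {ae mu, forall x, forall n, P (iter n T x)}.
Proof.
move=> [N [mN N0 hN]].
apply: (@negligibleS _ _ _ _ (\bigcup_n (iter n T @^-1` N))).
  by move=> x /= /existsNP[n Pn]; exists n => //; exact: hN.
apply: negligible_bigcup => n; exists (iter n T @^-1` N); split=> //.
  exact: measurable_preimage_iter.
by have [_ h] := iter_measure_preserving n; exact: etrans (h _ mN) N0.
Qed.

(* An almost invariant set agrees almost everywhere with its limsup under the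
   dynamics, which is strictly invariant. *)
Lemma ergodic_ae_invariant (E : set X) : ergodic mu T -> measurable E ->
  {ae mu, forall x, E x <-> E (T x)} -> mu E = 0%E \/ mu E = 1%E.
Proof.
move=> erg mE inv.
pose F := lim_sup_set (fun n => iter n T @^-1` E).
have mF : measurable F.
  apply: bigcap_measurable => // n _; apply: bigcup_measurable => k _.
  exact: measurable_preimage_iter.
have -> : mu E = mu F.
  apply: ae_measure_eq => //; apply: filterS (ae_iter inv) => x hx.
  have hn n : E x <-> E (iter n T x).
    by elim: n => [//|n IH]; rewrite IH; exact: hx.
  split=> [Ex n _|/(_ 0%N I)[k _ /=]]; last by rewrite -hn.
  by exists n => //=; rewrite -hn.
apply: erg => //; apply/seteqP; split=> x Fx n _.
  have [k /= nk] := Fx n I; rewrite -iterSr => h.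
  by exists k.+1 => //=; rewrite (leq_trans nk).
have [k /= nk h] := Fx n.+1 I.
case: k nk h => // k nk h; exists k => //=.
by rewrite -iterSr.
Qed.

(** The inequality [2 a <= 2^k a^2 + 2^-k] turns the bound on squares into an L^1 bound of order
    [2^-k]. The sum of the [|u k|] is then integrable, hence finite almost everywhere. *)
Lemma ae_cvg_series_of_L2 (u : nat -> X -> R) (C : R) : 0 <= C ->
  (forall k, u k \in @bounded_measurable d X R) ->
  (forall k, \int[mu]_x (u k x ^+ 2) <= C / (4 ^ k)%:R) ->
  {ae mu, forall x, cvgn (series (fun k => `|u k x|))}.
Proof.
move=> C0 ub u2.
have nb k := bounded_measurable_norm (ub k).
have ni k := bounded_measurable_integrable mu (nb k).
have le k : \int[mu]_x `|u k x| <= (2 * (C + 1)) / (2 ^ k.+1)%:R.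
  have p2 : 0 < (2 ^ k)%:R :> R by rewrite ltr0n expn_gt0.
  have sb : (fun x => (2 ^ k)%:R * u k x ^+ 2 + (2 ^ k)%:R^-1) \in @bounded_measurable d X R.
    have := rpredD (rpredZ (2 ^ k)%:R (bounded_measurableM (ub k) (ub k)))
      (bounded_measurable_cst X (2 ^ k)%:R^-1).
    by congr (_ \in _); apply/funext => x /=; rewrite expr2.
  apply: (@le_trans _ _ (\int[mu]_x ((2 ^ k)%:R * u k x ^+ 2 + (2 ^ k)%:R^-1))).
    apply: le_Rintegral => //; first exact: (bounded_measurable_integrable mu sb).
    move=> x _ /=; rewrite -(real_normK (num_real (u k x))).
    move: p2 (normr_ge0 (u k x)); set c : R := (2 ^ k)%:R; set a := `|_| => c0 a0.
    have : 0 <= c^-1 * (c * a - 1) ^+ 2 by rewrite mulr_ge0 ?sqr_ge0// invr_ge0 ltW.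
    have -> : c^-1 * (c * a - 1) ^+ 2 = c * a ^+ 2 + c^-1 - 2 * a.
      by field; rewrite gt_eqF.
    by lra.
  have si : mu.-integrable setT (EFin \o (fun x => u k x ^+ 2)).
    have := bounded_measurable_integrable mu (bounded_measurableM (ub k) (ub k)).
    by under eq_fun do rewrite -expr2.
  rewrite RintegralD//; last first.
  - exact/bounded_measurable_integrable/bounded_measurable_cst.
  - have := bounded_measurable_integrable mu
      (rpredZ (2 ^ k)%:R (bounded_measurableM (ub k) (ub k))).
    by congr (_.-integrable _ _); apply/funext => x /=; rewrite expr2.
  have -> : \int[mu]_x (2 ^ k)%:R^-1 = (2 ^ k)%:R^-1.
    rewrite Rintegral_cst// [X in fine X](_ : _ = 1%E) ?mulr1//.
    exact: probability_setT.
  rewrite RintegralZl//.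
  apply: (@le_trans _ _ ((2 ^ k)%:R * (C / (4 ^ k)%:R) + (2 ^ k)%:R^-1)).
    by rewrite lerD2r ler_wpM2l.
  rewrite (_ : 4 = 2 * 2)%N// expnMn expnS !natrM le_eqVlt; apply/orP; left; apply/eqP.
  by field; rewrite gt_eqF.
pose F x := (\sum_(k <oo) (`|u k x|)%:E)%E.
have nm k : measurable_fun setT (fun x => (`|u k x|)%:E).
  by apply/measurable_EFinP; have [] := bounded_measurableP _ (nb k).
have iF : mu.-integrable setT F.
  apply/integrableP; split; first exact: ge0_emeasurable_sum.
  under eq_integral do rewrite gee0_abs ?nneseries_ge0//.
  rewrite integral_nneseries//.
  apply: le_lt_trans (ltry (2 * (C + 1))).
  apply: le_trans (@epsilon_trick0 R (2 * (C + 1)) xpredT _); last by rewrite mulr_ge0// addr_ge0.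
  apply: lee_nneseries => [k _ _|k _]; first exact: integral_ge0.
  rewrite -[X in (X <= _)%E]fineK ?lee_fin; first exact: le.
  by apply: integrable_fin_num => //; exact: ni.
apply: filterS (integrable_ae measurableT iF) => x /(_ I) Fx.
apply: nondecreasing_is_cvgn.
  by apply: (@nondecreasing_series R (fun k => `|u k x|) xpredT 0).
exists (fine (F x)) => _ [n _ <-].
rewrite -lee_fin fineK// /series/= -sumEFin.
by apply: (@nneseries_lim_ge R (fun k => (`|u k x|)%:E) xpredT 0%N n).
Qed.

End ae_dynamics.

(** * Eigenfunctions *)

Section eigenfunction.
Context d (X : measurableType d) (R : realType) (mu : probability X R).

Lemma bounded_convergence (h : nat -> X -> R) (g : X -> R) (M : R) :
  (forall n, measurable_fun setT (h n)) -> (forall n x, `|h n x| <= M) ->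
  measurable_fun setT g -> {ae mu, forall x, h ^~ x @ \oo --> g x} ->
  mu.-integrable setT (EFin \o g) /\
  (fun n => \int[mu]_x h n x) @ \oo --> \int[mu]_x g x.
Proof.
move=> mh hM mg hg.
have [] := @dominated_convergence _ X R mu setT measurableT (fun n x => (h n x)%:E)
  (EFin \o g) (cst M%:E).
- by move=> n; exact/measurable_EFinP.
- exact/measurable_EFinP.
- by apply: filterS hg => x hx _; apply: cvg_EFin; [exact: nearW|exact: hx].
- exact/(@bounded_measurable_integrable _ _ _ mu (fun=> M))/bounded_measurable_cst.
- by apply: aeW => x n _ /=; rewrite lee_fin.
move=> ig _ cg; split=> //.
have gf : (\int[mu]_x (g x)%:E)%E \is a fin_num by exact: integrable_fin_num.
rewrite /Rintegral; apply: fine_cvg; rewrite fineK//.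
Qed.

Context (T : X -> X) (TP : measure_preserving mu T).
Local Notation U := (koopman TP).
Local Notation ip := (l2ip mu).

Lemma erg_avg_rot_bounded (f : bmfun X R) N t : (forall x, `|f x| <= 1) ->
  (forall x, `|(erg_avg (rot U t) N (f, 0)).1 x| <= 1) /\
  (forall x, `|(erg_avg (rot U t) N (f, 0)).2 x| <= 1).
Proof.
move=> f1; rewrite (erg_avg_rotE (koopman_isometry TP)) /=.
have key (c : nat -> R) x : (forall i, `|c i| <= 1) ->
    `|(N%:R^-1 *: \sum_(i < N) c i *: iter i U f) x| <= 1.
  move=> c1; rewrite bmfunZ bmfun_sum normrM.
  rewrite ger0_norm ?invr_ge0// mulrC.
  have [->|N0] := posnP N; first by rewrite invr0 mulr0.
  rewrite ler_pdivrMr ?ltr0n// mul1r (le_trans (ler_norm_sum _ _ _))//.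
  rewrite (@le_trans _ _ (\sum_(i < N) 1))//; last by rewrite sumr_const card_ord.
  by apply: ler_sum => i _; rewrite bmfunZ normrM iter_koopman mulr_ile1.
by split=> x; [apply: (key (fun i => cos (i%:R * t))) => i; exact: cos_max|
  apply: (key (fun i => sin (i%:R * t))) => i; exact: sin_max].
Qed.

Lemma erg_avg_rot_integral (f : bmfun X R) N t : \int[mu]_x f x = 0 ->
  \int[mu]_x (erg_avg (rot U t) N (f, 0)).1 x = 0 /\
  \int[mu]_x (erg_avg (rot U t) N (f, 0)).2 x = 0.
Proof.
move=> f0; rewrite (erg_avg_rotE (koopman_isometry TP)) /=.
have int0 g : g \in @bounded_measurable _ X R -> mu.-integrable setT (EFin \o g).
  exact: bounded_measurable_integrable.
have fi i : \int[mu]_x iter i U f x = 0.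
  elim: i => [//|i IH]; rewrite -[RHS]IH.
  exact: (Rintegral_comp TP (bmfunP (iter i U f))).
have key (c : nat -> R) : \int[mu]_x (N%:R^-1 *: \sum_(i < N) c i *: iter i U f) x = 0.
  have -> : \int[mu]_x (N%:R^-1 *: \sum_(i < N) c i *: iter i U f) x =
      N%:R^-1 * \int[mu]_x (\sum_(i < N) c i *: iter i U f) x.
    by rewrite -RintegralZl//; exact/int0/bmfunP.
  suff -> : \int[mu]_x (\sum_(i < N) c i *: iter i U f) x = 0 by rewrite mulr0.
  elim: N => [|n IH].
    rewrite big_ord0 (_ : Rintegral _ _ _ = \int[mu]_x cst 0 x)//.
    by rewrite Rintegral_cst// mul0r.
  rewrite big_ord_recr/= -[LHS]/(\int[mu]_x ((\sum_(i < n) c i *: iter i U f) x +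
    c n * iter n U f x)).
  rewrite RintegralD//; [|exact/int0/bmfunP|exact/int0/(bmfunP (c n *: iter n U f))].
  by rewrite IH add0r RintegralZl// ?fi ?mulr0//; exact/int0/bmfunP.
by split; [exact: (key (fun i => cos (i%:R * t)))|exact: (key (fun i => sin (i%:R * t)))].
Qed.

Lemma cvgn_of_telescope_norm (v : nat -> R) :
  cvgn (series (fun k => `|v k.+1 - v k|)) -> cvgn v.
Proof.
move=> /(@normed_cvg R R (telescope v)); rewrite telescopeK => h.
have -> : v = (fun n => (v n - v 0%N) + v 0%N) by apply/funext => n; rewrite subrK.
by apply: is_cvgD => //; exact: is_cvg_cst.
Qed.

Lemma cvg0_of_norm_series (v : nat -> R) :
  cvgn (series (fun k => `|v k|)) -> v @ \oo --> (0 : R).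
Proof. by move=> /cvg_series_cvg_0/norm_cvg0. Qed.

Lemma bmpair_cvg1 (G : nat -> bmfun X R * bmfun X R) x :
  cvgn (series (fun k => `|(G k.+1 - G k).1 x|)) -> cvgn (fun k => (G k).1 x).
Proof. exact: cvgn_of_telescope_norm. Qed.

Lemma bmpair_cvg2 (G : nat -> bmfun X R * bmfun X R) x :
  cvgn (series (fun k => `|(G k.+1 - G k).2 x|)) -> cvgn (fun k => (G k).2 x).
Proof. exact: cvgn_of_telescope_norm. Qed.

Lemma rot_limit (G : nat -> bmfun X R * bmfun X R) t x (a b : X -> R) :
  (fun k => (G k).1 x) @ \oo --> a x -> (fun k => (G k).2 x) @ \oo --> b x ->
  (fun k => (G k).1 (T x)) @ \oo --> a (T x) -> (fun k => (G k).2 (T x)) @ \oo --> b (T x) ->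
  (fun k => (rot U t (G k) - G k).1 x) @ \oo --> (0 : R) ->
  (fun k => (rot U t (G k) - G k).2 x) @ \oo --> (0 : R) ->
  a x = cos t * a (T x) - sin t * b (T x) /\ b x = sin t * a (T x) + cos t * b (T x).
Proof.
move=> a0 b0 a1 b1 w1 w2; split; apply/eqP; rewrite eq_sym -subr_eq0; apply/eqP.
- apply: cvg_unique w1 => //.
  have -> : (fun k => (rot U t (G k) - G k).1 x) =
    (fun k => cos t * (G k).1 (T x) - sin t * (G k).2 (T x) - (G k).1 x) by [].
  by apply: cvgB => //; apply: cvgB; apply: cvgMl_tmp.
- apply: cvg_unique w2 => //.
  have -> : (fun k => (rot U t (G k) - G k).2 x) =
    (fun k => sin t * (G k).1 (T x) + cos t * (G k).2 (T x) - (G k).2 x) by [].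
  by apply: cvgB => //; apply: cvgD; apply: cvgMl_tmp.
Qed.

(** The eigenfunction [a + i b] is the almost everywhere limit of twisted averages along a sparse
    sequence of lengths. The lower bound [e] on their norms keeps the limit from vanishing. *)
Lemma eigenfunction_exists (f : bmfun X R) t e : 0 < e ->
  (forall x, `|f x| <= 1) ->
  (forall k, e <= spectral_avg ip U f (2 ^ k) t) ->
  exists a b : X -> R,
  [/\ measurable_fun setT a, measurable_fun setT b,
    {ae mu, forall x, a x = cos t * a (T x) - sin t * b (T x) /\
                      b x = sin t * a (T x) + cos t * b (T x)},
    ~ {ae mu, forall x, a x = 0 /\ b x = 0} &
    \int[mu]_x f x = 0 ->
      [/\ mu.-integrable setT (EFin \o a), mu.-integrable setT (EFin \o b),
          \int[mu]_x a x = 0 & \int[mu]_x b x = 0]].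
Proof.
move=> e0 f1 he.
have aux (A B C p q : R) : A <= C + q -> B <= C + p -> q <= p ->
  2 * (A - C) + 2 * (B - C) <= 4 * p by lra.
have ipP := l2ip_semi_inner mu.
have [_ _ _ ip_ge0] := ipP.
have UP := koopman_isometry TP.
have ip2P := ip_pair_semi_inner ipP.
have WP := rot_isometry ipP UP t.
pose s k := spectral_avg ip U f (2 ^ k) t.
pose c := inf (range s).
have s_lb : has_lbound (range s) by exists e => _ [k _ <-]; exact: he.
have s_ne : range s !=set0 by exists (s 0%N), 0%N.
have cs k : c <= s k by apply: ge_inf => //; exists k.
have c0 : 0 <= c by apply: lb_le_inf => // _ [k _ <-]; rewrite (le_trans (ltW e0))// he.
have sd k m : (k <= m)%N -> s m <= s k.
  elim: m => [|m IH]; first by rewrite leqn0 => /eqP ->.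
  rewrite leq_eqVlt => /predU1P[<-//|/IH]; apply: le_trans.
  exact: (spectral_avg_pow2_antitone ipP UP).
have p4 k : 0 < (4 ^ k)%:R^-1 :> R by rewrite invr_gt0 ltr0n expn_gt0.
(* Norms within [4^-k] of their infimum make consecutive averages close by [erg_avg_cauchy];
   [k <= n] makes the defect of invariance equally small. Both are then summable. *)
have /choice[n_ hn] : forall k, exists n, (k <= n)%N /\ s n <= c + (4 ^ k)%:R^-1.
  move=> k.
  have [|_ [m _ <-] sm] := @inf_adherent _ (range s) (4 ^ k)%:R^-1 (p4 k); first by split.
  exists (maxn k m); split; first exact: leq_maxl.
  by rewrite (le_trans (sd m _ (leq_maxr k m)))// ltW.
pose G k := erg_avg (rot U t) (2 ^ n_ k) (f, 0).
have P20 n : (0 < 2 ^ n)%N by rewrite expn_gt0.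
have GP k : ip_pair ip (G k) (G k) = s (n_ k) by [].
have Gcau k : ip_pair ip (G k.+1 - G k) (G k.+1 - G k) <= 4 / (4 ^ k)%:R.
  have := erg_avg_cauchy ip2P WP (P20 (n_ k.+1)) (P20 (n_ k)) c0 cs.
  move=> /le_trans; apply; rewrite -!/(G _) !GP.
  have [_ h1] := hn k.+1; have [_ h2] := hn k.
  have h3 : (4 ^ k.+1)%:R^-1 <= (4 ^ k)%:R^-1 :> R.
    by rewrite lef_pV2 ?posrE ?ltr0n ?expn_gt0// ler_nat leq_exp2l.
  exact: aux h1 h2 h3.
pose w k := rot U t (G k) - G k.
have wle k : ip_pair ip (w k) (w k) <= (4 * ip f f) / (4 ^ k)%:R.
  have := ipnorm_erg_avg_invariant ip2P WP (f, 0) (P20 (n_ k)).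
  rewrite -/(G k) -/(w k) => h.
  rewrite -(sqr_ipnorm ip2P).
  have ff : ip_pair ip (f, 0) (f, 0) = ip f f.
    rewrite /ip_pair/= (_ : ip 0 0 = 0) ?addr0// -(scale0r 0).
    by have [_ _ -> _] := ipP; rewrite mul0r.
  apply: (@le_trans _ _ (((2 ^ n_ k)%:R^-1 * (2 * ipnorm (ip_pair ip) (f, 0))) ^+ 2)).
    by rewrite ler_pXn2r// nnegrE ?ipnorm_ge0// mulr_ge0 ?invr_ge0 ?mulr_ge0 ?ipnorm_ge0.
  rewrite exprMn exprMn (sqr_ipnorm ip2P) ff (_ : 2 ^+ 2 = 4 :> R); last by rewrite -natrX.
  rewrite mulrC exprVn -natrX -expnM mulnC expnM.
  rewrite ler_wpM2l ?mulr_ge0// lef_pV2 ?posrE ?ltr0n ?expn_gt0// ler_nat.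
  by rewrite (_ : (2 ^ 2)%N = 4%N)// leq_exp2l//; case: (hn k).
have G1 k x : `|(G k).1 x| <= 1 by have [] := erg_avg_rot_bounded (2 ^ n_ k) t f1.
have G2 k x : `|(G k).2 x| <= 1 by have [] := erg_avg_rot_bounded (2 ^ n_ k) t f1.
have Gint k : \int[mu]_x f x = 0 ->
    \int[mu]_x (G k).1 x = 0 /\ \int[mu]_x (G k).2 x = 0.
  exact: erg_avg_rot_integral.
have Ge k : e <= ip_pair ip (G k) (G k) by rewrite GP; exact: he.
(* From here only the recorded bounds on [G] matter, so its definition is forgotten. *)
move: G GP Gcau @w wle G1 G2 Gint Ge => G _ Gcau w wle G1 G2 Gint Ge.
have comp (v : nat -> bmfun X R * bmfun X R) C : 0 <= C ->
    (forall k, ip_pair ip (v k) (v k) <= C / (4 ^ k)%:R) ->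
    {ae mu, forall x, cvgn (series (fun k => `|(v k).1 x|)) /\
                      cvgn (series (fun k => `|(v k).2 x|))}.
  move=> C0 hv.
  have h1 : {ae mu, forall x, cvgn (series (fun k => `|(v k).1 x|))}.
    apply: (ae_cvg_series_of_L2 C0) => k; first exact: bmfunP.
    by rewrite (le_trans _ (hv k))// /ip_pair ler_wpDr// ip_ge0.
  have h2 : {ae mu, forall x, cvgn (series (fun k => `|(v k).2 x|))}.
    apply: (ae_cvg_series_of_L2 C0) => k; first exact: bmfunP.
    by rewrite (le_trans _ (hv k))// /ip_pair ler_wpDl// ip_ge0.
  by apply: filterS2 h1 h2.
have Gcvg : {ae mu, forall x, cvgn (fun k => (G k).1 x) /\ cvgn (fun k => (G k).2 x)}.
  have := comp (fun k => G k.+1 - G k) 4 (ler0n _ _) Gcau.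
  apply: filterS => x [h1 h2].
  by split; [exact: bmpair_cvg1 h1|exact: bmpair_cvg2 h2].
have Wcvg : {ae mu, forall x, (fun k => (w k).1 x) @ \oo --> (0 : R) /\
                              (fun k => (w k).2 x) @ \oo --> (0 : R)}.
  have := comp w (4 * ip f f) (mulr_ge0 (ler0n _ _) (ip_ge0 f)) wle.
  apply: filterS => x [h1 h2].
  by split; [exact: (@cvg0_of_norm_series (fun k => (w k).1 x) h1)|
    exact: (@cvg0_of_norm_series (fun k => (w k).2 x) h2)].
(* The upper limit is measurable on the whole space and equals the limit wherever the averages
   converge. *)
pose a x := limn_sup (fun k => (G k).1 x).
pose b x := limn_sup (fun k => (G k).2 x).
have msup (v : nat -> bmfun X R) : (forall k x, `|v k x| <= 1) ->
    measurable_fun setT (fun x => limn_sup (fun k => v k x)).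
  move=> v1; apply: (measurable_fun_limn_sup (h := fun k => v k)) => [x _|x _|k].
  - by exists 1 => _ [k _ <-]; have := v1 k x; rewrite ler_norml => /andP[].
  - by exists (-1) => _ [k _ <-]; have := v1 k x; rewrite ler_norml => /andP[].
  - by have [] := bounded_measurableP _ (bmfunP (v k)).
have ma : measurable_fun setT a by exact: (msup (fun k => (G k).1)).
have mb : measurable_fun setT b by exact: (msup (fun k => (G k).2)).
have Gab : {ae mu, forall x, (fun k => (G k).1 x) @ \oo --> a x /\
                             (fun k => (G k).2 x) @ \oo --> b x}.
  apply: filterS Gcvg => x [h1 h2].
  by split; [have /cvg_sups/cvg_lim E := h1|have /cvg_sups/cvg_lim E := h2];
    rewrite /a /b /limn_sup E.
exists a, b; split=> //.
- apply: filterS2 (ae_iter TP Gab) Wcvg => x hx [w1 w2].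
  have [a0 b0] := hx 0%N; have [a1 b1] := hx 1%N.
  exact: (rot_limit a0 b0 a1 b1 w1 w2).
- move=> ab0.
  (* If the limit vanished almost everywhere, bounded convergence would send the squared norms of
     [G k], all at least [e], to 0. *)
  pose h k x := (G k).1 x * (G k).1 x + (G k).2 x * (G k).2 x.
  have mG1 k := bounded_measurableM (bmfunP (G k).1) (bmfunP (G k).1).
  have mG2 k := bounded_measurableM (bmfunP (G k).2) (bmfunP (G k).2).
  have [||||_ hc] := @bounded_convergence h (cst 0) 2.
  + by move=> k; apply: measurable_funD;
      [have [] := bounded_measurableP _ (mG1 k)|have [] := bounded_measurableP _ (mG2 k)].
  + move=> k x; rewrite (le_trans (ler_normD _ _))// !normrM.
    by rewrite -[leRHS]/(1 + 1) lerD// mulr_ile1.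
  + exact: measurable_cst.
  + apply: filterS2 Gab ab0 => x [h1 h2] [ax bx].
    rewrite (_ : cst 0 x = a x * a x + b x * b x); last by rewrite ax bx !mul0r addr0.
    by apply: cvgD; apply: cvgM.
  move: hc; rewrite Rintegral_cst// mul0r => hc.
  suff : e <= 0 by rewrite leNgt e0.
  have ce : (fun _ : nat => e) @ \oo --> e by exact: cvg_cst.
  apply: (ler_cvg_to ce hc); apply: nearW => k.
  rewrite /h RintegralD//; [|exact: bounded_measurable_integrable..].
  exact: Ge.
- move=> f0.
  have [||||ia ca] := @bounded_convergence (fun k => (G k).1) a 1 => //.
  + by move=> k; have [] := bounded_measurableP _ (bmfunP (G k).1).
  + by apply: filterS Gab => x [].
  have [||||ib cb] := @bounded_convergence (fun k => (G k).2) b 1 => //.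
  + by move=> k; have [] := bounded_measurableP _ (bmfunP (G k).2).
  + by apply: filterS Gab => x [].
  split=> //.
  + have E : (fun k => \int[mu]_x (G k).1 x) = (fun=> 0).
      by apply/funext => k; have [] := Gint k f0.
    by rewrite E in ca; apply: (cvg_unique _ ca) => //; exact: cvg_cst.
  + have E : (fun k => \int[mu]_x (G k).2 x) = (fun=> 0).
      by apply/funext => k; have [] := Gint k f0.
    by rewrite E in cb; apply: (cvg_unique _ cb) => //; exact: cvg_cst.
Qed.

End eigenfunction.

(** * Farey approximations *)

(* The slow continued fraction (Farey) walk towards [alpha]: [p / q] and
   [p' / q'] are Farey neighbours below and above [alpha]. *)
Definition farey_state (R : realType) (alpha : R) (q q' : nat) (p p' : int) :=
  [/\ q%:Z * p' - q'%:Z * p = 1, (0 < q)%N, (0 < q')%N,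
      p%:~R < q%:R * alpha & q'%:R * alpha < p'%:~R].

Section farey.
Context (R : realType) (alpha : R).

Definition good_denominator (r : nat) (m : int) (N : nat) :=
  [/\ (0 < r)%N, (3 * r <= 2 * N)%N &
    forall (i : nat) (k : int), (0 < i < N)%N ->
      `|r%:R * alpha - m%:~R| <= `|i%:R * alpha - k%:~R|].

(** By the determinant, [(i, k)] is an integer combination [s (q, p) + t (q', p')]. The bounds on
    [i] exclude both coefficients being positive and both being nonpositive. As the displacements of
    [q] and [q'] have opposite signs, the two terms reinforce each other. *)
Lemma farey_gap q q' p p' : farey_state alpha q q' p p' ->
  forall (i : nat) (k : int), (0 < i < q + q')%N ->
  q%:R * alpha - p%:~R <= i%:R * alpha - k%:~R \/
  i%:R * alpha - k%:~R <= q'%:R * alpha - p'%:~R.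
Proof.
move=> [det q0 q'0 lo hi] i k /andP[i0 iN].
pose s : int := i%:Z * p' - q'%:Z * k.
pose t : int := q%:Z * k - i%:Z * p.
have iE : i%:Z = s * q%:Z + t * q'%:Z.
  transitivity (i%:Z * (q%:Z * p' - q'%:Z * p)); first by rewrite det mulr1.
  by rewrite /s /t; ring.
have kE : k = s * p + t * p'.
  transitivity (k * (q%:Z * p' - q'%:Z * p)); first by rewrite det mulr1.
  by rewrite /s /t; ring.
move: s t iE kE => s t iE kE.
set u := q%:R * alpha - p%:~R; set v := q'%:R * alpha - p'%:~R.
have u0 : 0 < u by rewrite subr_gt0.
have v0 : v < 0 by rewrite subr_lt0.
have -> : i%:R * alpha - k%:~R = s%:~R * u + t%:~R * v.
  have -> : i%:R = s%:~R * q%:R + t%:~R * q'%:R :> R.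
    by rewrite -[LHS]/(i%:Z%:~R) iE rmorphD/= !rmorphM/=.
  by rewrite kE /u /v !rmorphD/= !rmorphM/=; ring.
have [s0|s0] := leP 1 s.
  have [t0|t0] := leP 1 t; first by exfalso; nia.
  left; have s1 : 1 <= s%:~R :> R by rewrite -[1]/(1%:~R) ler_int.
  have t1 : t%:~R <= 0 :> R by rewrite -[0]/(0%:~R) ler_int; lia.
  by nra.
have [t0|t0] := leP 1 t; last by exfalso; nia.
right; have t1 : 1 <= t%:~R :> R by rewrite -[1]/(1%:~R) ler_int.
have s1 : s%:~R <= 0 :> R by rewrite -[0]/(0%:~R) ler_int; lia.
by nra.
Qed.

Lemma farey_gap_abs q q' p p' : farey_state alpha q q' p p' ->
  forall (i : nat) (k : int), (0 < i < q + q')%N ->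
  Num.min (q%:R * alpha - p%:~R) (p'%:~R - q'%:R * alpha) <= `|i%:R * alpha - k%:~R|.
Proof.
move=> st i k hi; have [h|h] := farey_gap st k hi; rewrite ge_min; apply/orP.
- by left; rewrite (le_trans h)// ler_norm.
- by right; rewrite -normrN (le_trans _ (ler_norm _))// opprB; lra.
Qed.

Context (irr : forall (i : nat) (k : int), (0 < i)%N -> i%:R * alpha != k%:~R).

(** The displacement of the mediant is the sum of the two displacements; its sign, nonzero by [irr],
    tells which neighbour the mediant replaces. *)
Lemma farey_step q q' p p' : farey_state alpha q q' p p' ->
  if q%:R * alpha - p%:~R < p'%:~R - q'%:R * alpha
  then farey_state alpha q (q + q') p (p + p')
  else farey_state alpha (q + q') q' (p + p') p'.
Proof.
move=> [det q0 q'0 lo hi].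
have : (q + q')%:R * alpha != (p + p')%:~R by apply: irr; rewrite addn_gt0 q0.
rewrite natrD intrD => ne.
case: ltP => h; split=> //; rewrite ?natrD ?intrD ?PoszD ?addn_gt0 ?q0 ?q'0//.
- by rewrite -[RHS]det; ring.
- by lra.
- by rewrite -[RHS]det; ring.
- by move: ne; rewrite neq_lt => /orP[|]; lra.
Qed.

Lemma farey_large : 0 < alpha < 1 -> forall Q : nat, exists q q' p p',
  farey_state alpha q q' p p' /\ (Q <= q + q')%N.
Proof.
move=> /andP[a0 a1]; elim=> [|Q [q [q' [p [p' [st le]]]]]].
  by exists 1%N, 1%N, 0, 1; split=> //; split; rewrite ?mul1r.
case: (st) (farey_step st) => _ q0 q'0 _ _.
case: ifP => h st'.
  by exists q, (q + q')%N, p, (p + p'); split=> //; lia.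
by exists (q + q')%N, q', (p + p'), p'; split=> //; lia.
Qed.

Lemma farey_min q q' p p' : farey_state alpha q q' p p' ->
  Num.min (q%:R * alpha - p%:~R) (p'%:~R - q'%:R * alpha) * (q + q')%:R <= 1.
Proof.
move=> [det q0 q'0 lo hi].
set u := _ - _; set v := _ - q'%:R * _.
(* [q v + q' u] is the determinant of the state. *)
have E : q%:R * v + q'%:R * u = 1.
  rewrite -[1 in RHS]/(1%:~R) -det rmorphB/= !rmorphM/= /u /v; ring.
rewrite -[leRHS]E natrD mulrDr; apply: lerD.
  by rewrite mulrC ler_wpM2l// ge_min lexx orbT.
by rewrite mulrC ler_wpM2l// ge_min lexx.
Qed.

(** The neighbour closer to [alpha] works with [N = q + q'] unless its denominator exceeds twice the
    other. In that case, after one mediant step, whichever neighbour is closer satisfies the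
    bound. *)
Lemma farey_good q q' p p' : farey_state alpha q q' p p' ->
  exists r m N, good_denominator r m N /\ `|r%:R * alpha - m%:~R| <=
      Num.min (q%:R * alpha - p%:~R) (p'%:~R - q'%:R * alpha).
Proof.
have good_lo a a' b b' : farey_state alpha a a' b b' ->
    a%:R * alpha - b%:~R <= b'%:~R - a'%:R * alpha -> (a <= 2 * a')%N ->
    good_denominator a b (a + a') /\ `|a%:R * alpha - b%:~R| = a%:R * alpha - b%:~R.
  move=> st h le; have [_ a0 a'0 lo hi] := st.
  have E : `|a%:R * alpha - b%:~R| = a%:R * alpha - b%:~R.
    by rewrite ger0_norm// subr_ge0 ltW.
  split=> //; split=> [//||i k hi']; first by lia.
  by rewrite E -(min_idPl h) farey_gap_abs.
have good_hi a a' b b' : farey_state alpha a a' b b' ->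
    b'%:~R - a'%:R * alpha <= a%:R * alpha - b%:~R -> (a' <= 2 * a)%N ->
    good_denominator a' b' (a + a') /\ `|a'%:R * alpha - b'%:~R| = b'%:~R - a'%:R * alpha.
  move=> st h le; have [_ a0 a'0 lo hi] := st.
  have E : `|a'%:R * alpha - b'%:~R| = b'%:~R - a'%:R * alpha.
    by rewrite distrC ger0_norm// subr_ge0 ltW.
  split=> //; split=> [//||i k hi']; first by lia.
  by rewrite E -(min_idPr h) farey_gap_abs.
move=> st; have [_ q0 q'0 lo hi] := st; have := farey_step st.
case: ltP => h st'.
  have [le|lt] := leqP q (2 * q').
    by have [g E] := good_lo _ _ _ _ st (ltW h) le; exists q, p, (q + q')%N; rewrite E.
  have [h'|h'] := leP (q%:R * alpha - p%:~R) ((p + p')%:~R - (q + q')%:R * alpha).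
    have [|g E] := good_lo _ _ _ _ st' h'; first by lia.
    by exists q, p, (q + (q + q'))%N; rewrite E.
  have [|g E] := good_hi _ _ _ _ st' (ltW h'); first by lia.
  by exists (q + q')%N, (p + p'), (q + (q + q'))%N; rewrite E ltW.
have [le|lt] := leqP q' (2 * q).
  by have [g E] := good_hi _ _ _ _ st h le; exists q', p', (q + q')%N; rewrite E.
have [h'|h'] := leP (p'%:~R - q'%:R * alpha) ((q + q')%:R * alpha - (p + p')%:~R).
  have [|g E] := good_hi _ _ _ _ st' h'; first by lia.
  by exists q', p', (q + q' + q')%N; rewrite E.
have [|g E] := good_lo _ _ _ _ st' (ltW h'); first by lia.
by exists (q + q')%N, (p + p'), (q + q' + q')%N; rewrite E ltW.
Qed.

(** A first state with [q + q' > Q] bounds from below, by [e], the displacement of every denominator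
    under [q + q']. A later state yields a good [r] of displacement less than [e], which is
    therefore at least [Q]. *)
Lemma good_denominator_irrational : 0 < alpha < 1 -> forall Q : nat,
  exists r m N, good_denominator r m N /\ (Q <= r)%N.
Proof.
move=> a01 Q.
have [q [q' [p [p' [st Qq]]]]] := farey_large a01 Q.+1.
set e := Num.min (q%:R * alpha - p%:~R) (p'%:~R - q'%:R * alpha).
have e0 : 0 < e by case: st => _ _ _ lo hi; rewrite lt_min !subr_gt0 lo.
have [t [t' [s [s' [st' le]]]]] := farey_large a01 (Num.truncn (e^-1)).+1.
have [r [m [N [g hr]]]] := farey_good st'.
exists r, m, N; split=> //; rewrite leqNgt; apply/negP => rQ.
have [r0 _ _] := g.
have : e <= `|r%:R * alpha - m%:~R|.
  by apply: (farey_gap_abs st); rewrite r0 (ltn_trans rQ).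
apply/negP; rewrite -ltNge (le_lt_trans hr)//.
have tp : 0 < (t + t')%:R :> R by rewrite ltr0n; lia.
have := farey_min st'; set d := Num.min _ _ => hd.
rewrite -(ltr_pM2r tp) (le_lt_trans hd)// mulrC -ltr_pdivrMr// mul1r.
by rewrite (lt_le_trans (truncnS_gt _))// ler_nat.
Qed.

End farey.

Lemma good_denominators (R : realType) (alpha : R) : 0 < alpha < 1 ->
  forall Q : nat, exists r m N, good_denominator alpha r m N /\ (Q <= r)%N.
Proof.
move=> a01 Q.
have [irr|/existsNP[i /existsNP[k /not_implyP[i0 /negP]]]] :=
  pselect (forall (i : nat) (k : int), (0 < i)%N -> i%:R * alpha != k%:~R).
  exact: good_denominator_irrational.
rewrite negbK => /eqP E.
(* When [i * alpha] is an integer, multiples of [i] have displacement 0, which is minimal whatever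
   [N] is. *)
exists (Q.+1 * i)%N, (Q.+1%:Z * k), (2 * (Q.+1 * i))%N; split; last by nia.
split=> [||j l _]; [by nia|by nia|].
by rewrite natrM rmorphM/= -mulrA E subrr normr0.
Qed.

(** * Arguments of complex numbers *)

Section angle.
Context {R : realType}.
Implicit Types a b u v : R.

Lemma cos_sin_period (k : int) u :
  cos (u + (pi *+ 2) * k%:~R) = cos u /\ sin (u + (pi *+ 2) * k%:~R) = sin u.
Proof.
have nat_case n v : cos (v + pi *+ 2 * n%:R) = cos v /\ sin (v + pi *+ 2 * n%:R) = sin v.
  by rewrite mulr_natr (periodicn (@cosD2pi R)) (periodicn (@sinD2pi R)).
case: k => n; first exact: nat_case.
rewrite NegzE; have [<- <-] := nat_case n.+1 (u + pi *+ 2 * (- n.+1%:Z)%:~R).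
by rewrite mulrNz mulrN subrK.
Qed.

Lemma cos_eq1 u : cos u = 1 -> exists k : int, u = pi *+ 2 * k%:~R.
Proof.
move=> cu; have pp : 0 < pi *+ 2 :> R by rewrite pmulrn_rgt0// pi_gt0.
pose k := Num.floor (u / (pi *+ 2)); exists k.
have /andP[h1 h2] := floor_itv (u / (pi *+ 2)); rewrite -/k in h1 h2.
pose y := (u - pi *+ 2 * k%:~R) / 2.
have uE : u = y *+ 2 + pi *+ 2 * k%:~R by rewrite /y -mulr_natr; field.
have y0 : 0 <= y.
  by rewrite /y divr_ge0// subr_ge0 mulrC -ler_pdivlMr.
have y1 : y < pi.
  rewrite /y ltr_pdivrMr// mulr_natr ltrBlDr.
  by move: h2; rewrite ltr_pdivrMr// intrD; lra.
have : cos (y *+ 2) = 1 by have [<- _] := cos_sin_period k (y *+ 2); rewrite -uE.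
rewrite cos_mulr2n cos2sin2 => sy.
have s0 : sin y = 0 by apply/eqP; rewrite -sqrf_eq0; apply/eqP; lra.
have [y00|yp] := eqVneq y 0; first by rewrite {1}uE y00 mul0rn add0r.
suff : 0 < sin y by rewrite s0 ltxx.
by apply: sin_gt0_pi; rewrite lt_neqAle eq_sym yp y0.
Qed.

Lemma cos_sin_inj u v : cos u = cos v -> sin u = sin v ->
  exists k : int, u = v + pi *+ 2 * k%:~R.
Proof.
move=> cuv suv.
have /cos_eq1[k E] : cos (u - v) = 1 by rewrite cosB cuv suv -!expr2 cos2Dsin2.
by exists k; rewrite -E addrC subrK.
Qed.

(* The argument of [a + i b] in turns, via cot(phi/2) = b / (r - a). *)
Definition turn a b : R :=
  let r := Num.sqrt (a ^+ 2 + b ^+ 2) in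
  if r == a then 0 else 2^-1 - atan (b / (r - a)) / pi.

Lemma turn_itv a b : 0 <= turn a b < 1.
Proof.
rewrite /turn; case: ifP => _; first by rewrite lexx ltr01.
have p0 := pi_gt0 R.
set w := _ / (_ - _).
have : - 2^-1 < atan w / pi < 2^-1.
  have := atan_gtNpi2 w; have := atan_ltpi2 w => h1 h2.
  by rewrite ltr_pdivlMr// ltr_pdivrMr//; apply/andP; split; lra.
by move=> /andP[? ?]; lra.
Qed.

Lemma turnP a b : (a, b) != (0, 0) ->
  let r := Num.sqrt (a ^+ 2 + b ^+ 2) in
  [/\ 0 < r, a = r * cos (pi *+ 2 * turn a b) & b = r * sin (pi *+ 2 * turn a b)].
Proof.
move=> ab0 r.
have n0 : 0 < a ^+ 2 + b ^+ 2.
  rewrite lt_neqAle eq_sym addr_ge0 ?sqr_ge0// andbT paddr_eq0 ?sqr_ge0//.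
  by rewrite !sqrf_eq0 -xpair_eqE.
have r0 : 0 < r by rewrite sqrtr_gt0.
have r2 : r ^+ 2 = a ^+ 2 + b ^+ 2 by rewrite sqr_sqrtr// ltW.
rewrite /turn -/r; case: eqP => [ra|ra].
  rewrite mulr0 cos0 sin0 mulr1 mulr0; split=> //.
  by apply/eqP; rewrite -sqrf_eq0; apply/eqP; move: r2; rewrite ra; lra.
have ra0 : r - a != 0 by rewrite subr_eq0; apply/eqP.
have p0 : pi != 0 :> R by rewrite gt_eqF// pi_gt0.
set w := b / (r - a).
have aux (p t : R) : p != 0 -> p *+ 2 * (2^-1 - t / p) = - (t *+ 2) + p.
  by move=> pn0; rewrite -(mulr_natr p) -(mulr_natr t); field.
rewrite (aux pi (atan w) p0).
(* Hence [cos (atan w) ^+ 2 = (r - a) / (2 r)], and the double-angle formulas give back [a / r] and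
   [b / r]. *)
have w1 : 1 + w ^+ 2 = 2 * r / (r - a).
  have -> : 1 + w ^+ 2 = ((r - a) ^+ 2 + b ^+ 2) / (r - a) ^+ 2 by rewrite /w; field.
  have -> : (r - a) ^+ 2 + b ^+ 2 = 2 * r * (r - a).
    by rewrite (_ : b ^+ 2 = r ^+ 2 - a ^+ 2); [ring|rewrite r2; ring].
  by field.
have w0 : 0 < 1 + w ^+ 2 by rewrite ltr_pwDl// sqr_ge0.
have c2 : cos (atan w) ^+ 2 = (1 + w ^+ 2)^-1.
  by rewrite cos_atan exprVn sqr_sqrtr// ltW.
have c0 : cos (atan w) != 0 by rewrite -sqrf_eq0 c2 invr_eq0 gt_eqF.
have sE : sin (atan w) = w * cos (atan w).
  by rewrite -{2}(atanK w) /tan divfK.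
rewrite cosDpi sinDpi cosN sinN opprK cos_mulr2n sin_mulr2n sE.
rewrite (_ : cos (atan w) * (w * cos (atan w)) = w * cos (atan w) ^+ 2); last by ring.
rewrite c2 w1; split=> //.
  by field; rewrite ra0 gt_eqF.
by rewrite /w; field; rewrite ra0 gt_eqF.
Qed.

Lemma measurable_turn d (X : measurableType d) (a b : X -> R) :
  measurable_fun setT a -> measurable_fun setT b ->
  measurable_fun setT (fun x => turn (a x) (b x)).
Proof.
move=> ma mb.
have mr : measurable_fun setT (fun x => Num.sqrt (a x ^+ 2 + b x ^+ 2)).
  apply: (measurableT_comp (continuous_measurable_fun (@sqrt_continuous R))).
  by apply: measurable_funD; apply: measurable_funX.
have mi : measurable_fun setT (fun x => (Num.sqrt (a x ^+ 2 + b x ^+ 2) - a x)^-1).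
  (* Here [r - a] is nonnegative, so its inverse is a real power, known to be measurable. *)
  rewrite (_ : (fun x => _) = (fun x => (Num.sqrt (a x ^+ 2 + b x ^+ 2) - a x) `^ (-1))).
    apply: (measurableT_comp (measurable_powR (R := R) (-1))).
    exact: measurable_funB.
  apply/funext => x; rewrite powR_inv1// subr_ge0 (le_trans (ler_norm _))//.
  by rewrite -sqrtr_sqr ler_sqrt ?lerDl ?addr_ge0 ?sqr_ge0.
rewrite /turn; apply: measurable_fun_ifT; first exact: measurable_fun_eqr.
  exact: measurable_cst.
apply: measurable_funB; first exact: measurable_cst.
apply: measurable_funM; last exact: measurable_cst.
apply: (measurableT_comp (continuous_measurable_fun (@continuous_atan R))).
exact: measurable_funM.
Qed.

End angle.

(** * Rotation factors return fast *)

(** The circle is cut open to [[0, 1[], and the subtracted indicator records the wrap-around. The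
    angle [alpha] may be rational. *)
Definition rotation_factor d (X : measurableType d) (R : realType)
    (mu : probability X R) (T : X -> X) (rho : X -> R) (alpha : R) :=
  [/\ measurable_fun setT rho, forall x, 0 <= rho x < 1, 0 < alpha < 1 &
      {ae mu, forall x, rho (T x) = rho x + alpha - (1 - alpha <= rho x)%R%:R}].

Section no_rotation_factor.
Context d (X : measurableType d) (R : realType) (mu : probability X R).
Context (T : X -> X) (TP : measure_preserving mu T) (rho : X -> R) (alpha : R).
Context (rhoP : rotation_factor mu T rho alpha).

Let rho_itv : forall x, 0 <= rho x < 1. Proof. by case: rhoP. Qed.

Definition regular_point (x : X) := forall n, rho (iter n.+1 T x) =
  rho (iter n T x) + alpha - (1 - alpha <= rho (iter n T x))%R%:R.

Lemma ae_regular_point : {ae mu, forall x, regular_point x}.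
Proof.
have [_ _ _ /(ae_iter TP) h] := rhoP.
by apply: filterS h => x hx n; exact: hx.
Qed.

Lemma regular_point_iter n x : regular_point x -> regular_point (iter n T x).
Proof. by move=> hx m; rewrite -!iterD addSn; exact: hx. Qed.

Lemma regular_orbit x n : regular_point x ->
  exists k : int, rho (iter n T x) = rho x + n%:R * alpha - k%:~R.
Proof.
move=> hx; elim: n => [|n [k IH]]; first by exists 0; rewrite mul0r addr0 subr0.
exists (k + (1 - alpha <= rho (iter n T x))%R%:Z).
by rewrite hx IH intrD -natr1 -pmulrn; ring.
Qed.

Let ae_ex (P : X -> Prop) : {ae mu, forall x, P x} -> exists x, P x.
Proof.
move=> h; apply: (@filter_ex _ (almost_everywhere mu)) => //.
apply: ae_properfilter_algebraOfSetsType.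
by rewrite [X in (_ < X)%E](_ : _ = 1%E) ?lte01//; exact: probability_setT.
Qed.

Definition rotation_cell : set X := [set x | 1 - alpha <= rho x].

Lemma measurable_rho_ge (s : R) : measurable [set x | s <= rho x].
Proof.
have [mrho _ _ _] := rhoP.
rewrite (_ : [set x | _] = setT `&` rho @^-1` `[s, +oo[%classic).
  exact: mrho.
by apply/seteqP; split=> x /=; rewrite in_itv/= andbT// => -[].
Qed.

(** If the rotation almost never, or almost always, wrapped around, [rho] would move by a constant
    nonzero step along almost every orbit and leave [[0, 1[]. *)
Lemma rotation_cell_nontrivial : mu rotation_cell != 0%E /\ mu rotation_cell != 1%E.
Proof.
have [_ _ /andP[a0 a1] _] := rhoP.
have mA := measurable_rho_ge (1 - alpha).
have contra (e : R) : e != 0 -> {ae mu, forall x, rho (T x) = rho x + e} -> False.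
  move=> e0 /(ae_iter TP)/ae_ex[x hx].
  have E n : rho (iter n T x) = rho x + n%:R * e.
    by elim: n => [|n IH]; rewrite ?mul0r ?addr0// hx IH -natr1; ring.
  pose n := (Num.truncn (`|e|^-1)).+1.
  have : 1 < n%:R * `|e| by rewrite -ltr_pdivrMr ?normr_gt0// div1r truncnS_gt.
  apply/negP; rewrite -leNgt -[n%:R]ger0_norm// -normrM.
  have := E n; have /andP[] := rho_itv x; have /andP[] := rho_itv (iter n T x).
  by move=> ? ? ? ? ?; rewrite ler_norml; apply/andP; split; lra.
have [_ _ _ h] := rhoP.
split; apply/eqP => muA.
  apply: (contra alpha); first by rewrite gt_eqF.
  by apply: filterS2 h (ae_measure0 mA muA) => x -> /= /negP/negbTE ->; rewrite subr0.
apply: (contra (alpha - 1)); first by rewrite lt_eqF// subr_lt0.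
by apply: filterS2 h (measure1_ae mA muA) => x -> /= ->; rewrite addrA.
Qed.

(* The arc that must be avoided for [x] and [T^r x] to be coded alike, where the
   rotation by [r * alpha] displaces by [s]. *)
Definition crossing_arc (s : R) : set X :=
  if 0 <= s then [set x | 1 - s <= rho x] else [set x | rho x < - s].

Lemma measurable_crossing_arc s : measurable (crossing_arc s).
Proof.
rewrite /crossing_arc; case: ifP => _; first exact: measurable_rho_ge.
rewrite (_ : [set x | _] = ~` [set x | - s <= rho x]).
  exact/measurableC/measurable_rho_ge.
by apply/seteqP; split=> x /=; rewrite ltNge => /negP.
Qed.

Lemma crossing_arc_diam s x y : crossing_arc s x -> crossing_arc s y ->
  `|rho x - rho y| < `|s|.
Proof.
have /andP[x0 x1] := rho_itv x; have /andP[y0 y1] := rho_itv y.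
rewrite /crossing_arc; case: ifP => [s0|/negbT]; last rewrite -ltNge => s0; rewrite /= => hx hy.
  by rewrite (ger0_norm s0) ltr_norml; apply/andP; split; lra.
by rewrite (ltr0_norm s0) ltr_norml; apply/andP; split; lra.
Qed.

(** The two sides agree modulo 1, and off the arc the right-hand side stays in [[0, 1[]. *)
Lemma crossing_arc_shift r m y : regular_point y ->
  ~ crossing_arc (r%:R * alpha - m%:~R) y ->
  rho (iter r T y) = rho y + (r%:R * alpha - m%:~R).
Proof.
move=> hy; set s := _ - _ => ncr.
have [k E] := regular_orbit r hy.
have sy : 0 <= rho y + s < 1.
  have /andP[y0 y1] := rho_itv y.
  move: ncr; rewrite /crossing_arc; case: ifP => [s0|/negbT].
    by move=> /negP; rewrite /= -ltNge => h; apply/andP; split; lra.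
  by rewrite -ltNge => s0 /negP; rewrite /= -leNgt => h; apply/andP; split; lra.
have E' : rho (iter r T y) = rho y + s + (m - k)%:~R by rewrite E /s intrB; ring.
have /andP[h1 h2] := rho_itv (iter r T y).
have /andP[h3 h4] := sy.
move: E'; set z : int := m - k => E'.
have k1 : z%:~R < 1 :> R by lra.
have k2 : - 1 < z%:~R :> R by lra.
have k0 : z = 0.
  move: k1 k2; rewrite -[1]/(1%:~R) -mulrNz !ltr_int; lia.
by rewrite E' k0 addr0.
Qed.

(** The first [N] preimages of the arc are disjoint: two visits at times [i < j] would make the
    displacement of [j - i] smaller than that of [r], against the minimality of [r]. *)
Lemma mu_crossing_arc r m N : good_denominator alpha r m N ->
  (N%:R%:E * mu (crossing_arc (r%:R * alpha - m%:~R)) <= 1)%E.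
Proof.
move=> [r0 rN gap]; set s := _ - _; set D := crossing_arc s.
have mD := measurable_crossing_arc s.
have [Z [mZ Z0 hZ]] := ae_regular_point.
(* Removing the points without a regular orbit makes the preimages disjoint exactly, not merely up
   to null sets. *)
pose D' := D `\` Z.
have mD' : measurable D' by exact: measurableD.
have DD' : mu D = mu D'.
  apply: ae_measure_eq => //; exists Z; split=> // x /= h.
  apply: contrapT => Zx; apply: h; rewrite /D'; split=> [Dx|[Dx _]].
    by split.
  exact: Dx.
pose F i := if (i < N)%N then iter i T @^-1` D' else set0.
have mF i : measurable (F i).
  by rewrite /F; case: ifP => // _; exact: (measurable_preimage_iter TP).
have tF : trivIset setT F.
  apply/trivIsetP => i j _ _.
  wlog ij : i j / (i < j)%N.
    move=> hw ij; have [h|h|h] := ltngtP i j; first exact: hw.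
      by rewrite setIC; apply: hw => //; rewrite eq_sym.
    by rewrite h eqxx in ij.
  move=> _; apply/seteqP; split=> // x; rewrite /F.
  case: ifP => [iN|_ []//]; case: ifP => [jN|_ []//].
  move=> [[Di Zi] [Dj _]].
  have ri : regular_point (iter i T x) by apply: contrapT => h; apply: Zi; exact: hZ.
  have [k E] := regular_orbit (j - i) ri.
  have := crossing_arc_diam Dj Di.
  rewrite -{1}(subnK (ltnW ij)) iterD E.
  rewrite [X in `|X|](_ : _ = (j - i)%N%:R * alpha - k%:~R); last by ring.
  rewrite ltNge gap// subn_gt0 ij/=; lia.
have : (mu (\big[setU/set0]_(i < N) F i) <= 1)%E.
  by apply: probability_le1; apply: bigsetU_measurable.
rewrite (@measure_bigsetU _ _ _ mu F)//.
rewrite (eq_bigr (fun=> mu D)); last first.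
  move=> i _; rewrite /F ltn_ord DD'.
  by have [_ h] := iter_measure_preserving TP i; exact: h.
have Df : mu D \is a fin_num by exact: fin_num_measure.
by rewrite -(fineK Df) sumEFin sumr_const card_ord -EFinM mulr_natl.
Qed.

(** Time [n] is included, although [atom_n] stops before it, because the cell at time [j] is read
    off from [rho] at times [j] and [j.+1]. *)
Definition recurrent_points (r : nat) (m : int) (n : nat) : set X :=
  [set x | forall j, (j <= n)%N -> ~ crossing_arc (r%:R * alpha - m%:~R) (iter j T x)].

Lemma recurrent_pointsE r m n : recurrent_points r m n =
  ~` \big[setU/set0]_(i < n.+1) (iter i T @^-1` crossing_arc (r%:R * alpha - m%:~R)).
Proof.
rewrite -(bigcup_mkord n.+1
  (fun i => iter i T @^-1` crossing_arc (r%:R * alpha - m%:~R))).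
apply/seteqP; split=> x /=.
  by move=> h [i /= ilt Ci]; exact: (h i).
by move=> h j jn Cj; apply: h; exists j.
Qed.

Lemma measurable_recurrent_points r m n : measurable (recurrent_points r m n).
Proof.
rewrite recurrent_pointsE; apply: measurableC; apply: bigsetU_measurable => i _.
exact/(measurable_preimage_iter TP)/measurable_crossing_arc.
Qed.

(** Union bound: the complement has measure at most [n.+1 / N <= 5 / 6]. *)
Lemma mu_recurrent_points r m n N : good_denominator alpha r m N ->
  (6 * n.+1 <= 5 * N)%N -> ((6^-1)%:E <= mu (recurrent_points r m n))%E.
Proof.
move=> g nN; have := mu_crossing_arc g.
set D := crossing_arc _ => NmD.
have mD : measurable D by exact: measurable_crossing_arc.
rewrite recurrent_pointsE -/D.
set B := \big[setU/set0]_(i < n.+1) _.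
have mB : measurable B.
  by apply: bigsetU_measurable => i _; exact: (measurable_preimage_iter TP).
have BD : (mu B <= n.+1%:R%:E * mu D)%E.
  have mi i : (i < n.+1)%N -> measurable (iter i T @^-1` D).
    by move=> _; exact: (measurable_preimage_iter TP).
  apply: (le_trans (@Boole_inequality _ _ _ mu (fun i => iter i T @^-1` D) n.+1 mi)).
  rewrite (eq_bigr (fun=> mu D)); last first.
    by move=> i _; have [_ h] := iter_measure_preserving TP i; exact: h.
  have Df : mu D \is a fin_num by exact: fin_num_measure.
  by rewrite -(fineK Df) sumEFin sumr_const card_ord -EFinM mulr_natl.
have Df : mu D \is a fin_num by exact: fin_num_measure.
have Bf : mu B \is a fin_num by exact: fin_num_measure.
have -> : mu (~` B) = (1 - fine (mu B))%:E.
  by rewrite EFinB fineK//; exact: probability_setC.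
move: NmD BD; have := fineK Df; have := fineK Bf.
set dd := fine (mu D); set bb := fine (mu B) => <- <-.
rewrite -!EFinM !lee_fin => h1 h2.
have d0 : 0 <= dd by rewrite fine_ge0.
have : 6 * n.+1%:R <= 5 * N%:R :> R by rewrite -!natrM ler_nat.
by move=> h3; nra.
Qed.

Definition cell_partition (i : 'I_2) : set X :=
  if i == ord0 then rotation_cell else ~` rotation_cell.

Lemma cell_partitionP : finite_meas_partition cell_partition /\
  nontrivial_partition mu cell_partition.
Proof.
have mA : measurable rotation_cell by exact: measurable_rho_ge.
have [A0 A1] := rotation_cell_nontrivial.
split; first split.
- by move=> i; rewrite /cell_partition; case: ifP => // _; exact: measurableC.
- move=> i j ij; rewrite /cell_partition.
  have [i0|i0] := eqVneq i ord0; have [j0|j0] := eqVneq j ord0.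
  + by rewrite i0 j0 eqxx in ij.
  + by rewrite setICr.
  + by rewrite setICl.
  + case/eqP: ij; apply: val_inj.
    by move: i0 j0; rewrite -!val_eqE/=; case: i => -[|[|]]//= ?; case: j => -[|[|]].
- apply/seteqP; split=> // x _.
  have [Ax|Ax] := pselect (rotation_cell x); first by exists ord0.
  by exists ord_max => //; rewrite /cell_partition ifF.
- move=> i; rewrite /cell_partition; case: ifP => // _.
  have Af : mu rotation_cell \is a fin_num by exact: fin_num_measure.
  have -> : mu (~` rotation_cell) = (1 - fine (mu rotation_cell))%:E.
    by rewrite EFinB fineK//; exact: probability_setC.
  move: A0 A1; have := fineK Af; set c := fine _ => <-; rewrite !eqe => c0 c1.
  by split; apply/eqP => h; [move/eqP: c1|move/eqP: c0]; apply; lra.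
Qed.

(** The indicator of the cell at [y] is [rho y + alpha - rho (T y)], which does not change when both
    values of [rho] are shifted by the same amount. *)
Lemma recurrent_points_name r m n x : regular_point x -> recurrent_points r m n x ->
  atom_n T cell_partition n x (iter r T x).
Proof.
move=> rx hx j jn.
have sh i : (i <= n)%N -> rho (iter r T (iter i T x)) =
    rho (iter i T x) + (r%:R * alpha - m%:~R).
  by move=> /hx; apply: crossing_arc_shift; exact: regular_point_iter.
have C i : iter r T (iter i T x) = iter i T (iter r T x) by rewrite -!iterD addnC.
have hj := sh j (ltnW jn); have hj1 := sh j.+1 jn.
have e1 := rx j; have e2 := regular_point_iter r rx j.
rewrite !C in hj hj1.
have E : (1 - alpha <= rho (iter j T x)) = (1 - alpha <= rho (iter j T (iter r T x))).
  have : (1 - alpha <= rho (iter j T x))%R%:R =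
    (1 - alpha <= rho (iter j T (iter r T x)))%R%:R :> R by lra.
  by move/eqP; rewrite eqr_nat; case: (_ <= _); case: (_ <= _).
have [Ax|Ax] := boolP (1 - alpha <= rho (iter j T x)).
  by exists ord0; rewrite /cell_partition/= /rotation_cell/= -E.
by exists ord_max; rewrite /cell_partition/= /rotation_cell/= -E; split; exact/negP.
Qed.

Lemma lower_rec_rate_le (x : X) (c : R) :
  (forall Q : nat, exists r n : nat, [/\ (Q <= n)%N, (0 < r)%N,
     atom_n T cell_partition n x (iter r T x) & r%:R <= c * n%:R]) ->
  (lower_rec_rate T cell_partition x <= c%:E)%E.
Proof.
move=> h; rewrite /lower_rec_rate limn_einf_lim; apply: lime_le; first exact: is_cvg_einfs.
apply: nearW => Q; apply: ge_ereal_inf.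
(* The successor ensures [n > 0] for the division. *)
have [r [n [Qn r0 hr rc]]] := h Q.+1.
have n0 : (0 < n)%N by rewrite (leq_trans _ Qn).
exists (poincare_rec T (atom_n T cell_partition n x) / (n%:R)%:E)%E.
  by exists n => //=; exact: ltnW.
have np : 0 < n%:R :> R by rewrite ltr0n.
rewrite inver gt_eqF//.
apply: (@le_trans _ _ (r%:R%:E * (n%:R^-1)%:E)%E).
  apply: lee_wpmul2r; first by rewrite lee_fin invr_ge0.
  apply: ge_ereal_inf; exists r%:R%:E => //; exists r => //; split=> //.
  exists x; split=> // j jn.
  by have [i [Pi _]] := hr j jn; exists i.
by rewrite -EFinM lee_fin ler_pdivrMr.
Qed.

Lemma no_rotation_factor :
  ~ (forall (k : nat) (P : 'I_k -> set X),
     finite_meas_partition P -> nontrivial_partition mu P ->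
     {ae mu, forall x, (1 <= lower_rec_rate (R:=R) T P x)%E}).
Proof.
move=> H.
have [fp np] := cell_partitionP.
have Hp := H _ _ fp np.
have [_ _ a01 _] := rhoP.
have /choice[g hg] : forall Q : nat, exists g : nat * int * nat,
    good_denominator alpha g.1.1 g.1.2 g.2 /\ (Q + 16 <= g.1.1)%N.
  by move=> Q; have [r [m [N h]]] := good_denominators a01 (Q + 16); exists (r, m, N).
(* A time just below [5 r / 4] serves both requirements: [r <= 8 n / 9] for fast return and
   [n.+1 <= 5 N / 6] for the measure. The margin 16 in the choice of [g] absorbs the rounding. *)
pose n Q := ((5 * (g Q).1.1) %/ 4).-1.
have nP Q : [/\ (9 * (g Q).1.1 <= 8 * n Q)%N, (6 * (n Q).+1 <= 5 * (g Q).2)%N & (Q <= n Q)%N].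
  have [[r0 rN _] rQ] := hg Q; rewrite /n; set r := (g Q).1.1 in r0 rN rQ *.
  by split; lia.
pose G Q := recurrent_points (g Q).1.1 (g Q).1.2 (n Q).
have mG Q : measurable (G Q) by exact: measurable_recurrent_points.
have muG Q : ((6^-1)%:E <= mu (G Q))%E.
  by have [? ? ?] := nP Q; have [g1 _] := hg Q; exact: mu_recurrent_points g1 _.
have mL : measurable (lim_sup_set G).
  by apply: bigcap_measurable => // k _; exact: bigcup_measurable.
(* Sets of measure at least 1/6 have an upper limit of measure at least 1/6; on almost all of it the
   recurrence rate is at most 8/9. *)
have L6 : ((6^-1)%:E <= mu (lim_sup_set G))%E.
  have fin : (mu (\bigcup_(k >= 0) G k) < +oo)%E.
    by rewrite (le_lt_trans (probability_le1 _ _)) ?ltry//; exact: bigcup_measurable.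
  have := lim_sup_set_cvg mu G mG fin => /cvg_lim <-//.
  apply: lime_ge; first by apply: cvgP (lim_sup_set_cvg mu G mG fin).
  apply: nearW => k; apply: (le_trans (muG k)).
  apply: le_measure; rewrite ?inE//; first exact: bigcup_measurable.
  by move=> x Gx; exists k => /=.
suff : mu (lim_sup_set G) = 0%E.
  by move=> E; move: L6; rewrite E lee_fin; lra.
apply/negligibleP => //.
apply: (negligibleS _ (filterI Hp ae_regular_point)) => x Lx /= [Hx rx].
suff : (lower_rec_rate T cell_partition x <= (8 / 9 : R)%:E)%E.
  by move=> h; have := le_trans Hx h; rewrite lee_fin; lra.
apply: lower_rec_rate_le => Q.
have [k /= Qk Gk] := Lx Q I.
have [n1 n2 n3] := nP k; have [[r0 _ _] _] := hg k.
exists (g k).1.1, (n k); split=> //; first exact: leq_trans n3.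
  exact: recurrent_points_name Gk.
by move: n1; rewrite -(ler_nat R) !natrM; lra.
Qed.

End no_rotation_factor.

(** * From eigenfunctions to rotation factors *)

Lemma intr_gtN2_lt1 (R : realType) (z : int) :
  - 2 < z%:~R :> R -> z%:~R < 1 :> R -> z = 0 \/ z = -1.
Proof.
rewrite -[1]/(1%:~R : R) -[2]/(2%:~R : R) -mulrNz !ltr_int => h1 h2.
by lia.
Qed.

Section rotation_factor_exists.
Context d (X : measurableType d) (R : realType) (mu : probability X R).
Context (T : X -> X) (TP : measure_preserving mu T) (erg : ergodic mu T).

Lemma measurable_gt0 (u : X -> R) : measurable_fun setT u -> measurable [set x | 0 < u x].
Proof.
move=> mu0; rewrite (_ : [set x | _] = setT `&` u @^-1` `]0, +oo[%classic).
  exact: mu0.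
by apply/seteqP; split=> x /=; rewrite in_itv/= andbT// => -[].
Qed.

(** Applied with [s = 1] and [s = -1]: the L^1 norm of a function of constant sign is its integral
    up to sign. *)
Lemma ae_eq0_of_norm (u : X -> R) (s : R) : mu.-integrable setT (EFin \o u) ->
  \int[mu]_x u x = 0 -> {ae mu, forall x, `|u x| = s * u x} -> {ae mu, forall x, u x = 0}.
Proof.
move=> iu u0 us.
have mEu : measurable_fun setT (EFin \o u) by case/integrableP: iu.
have z : (\int[mu]_x (u x)%:E)%E = 0%E.
  by rewrite -(fineK (integrable_fin_num measurableT iu)) -[X in X%:E]/(\int[mu]_x u x) u0.
have /(ae_eq_integral_abs mu measurableT mEu) h : (\int[mu]_x `|(EFin \o u) x|)%E = 0%E.
  transitivity (\int[mu]_x (s%:E * (u x)%:E))%E.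
    apply: ae_eq_integral => //; first exact: measurableT_comp.
      exact: (measurable_funeM s%:E mEu).
    by apply: filterS us => x ux _ /=; rewrite -EFinM -ux.
  by rewrite integralZl// z mule0.
by apply: filterS h => x /(_ I) /= [].
Qed.

(** The set where [u] is positive is invariant, hence null or of full measure, so [u] has constant
    sign. *)
Lemma ergodic_invariant_mean0 (u : X -> R) : mu.-integrable setT (EFin \o u) ->
  measurable_fun setT u ->
  \int[mu]_x u x = 0 -> {ae mu, forall x, u x = u (T x)} -> {ae mu, forall x, u x = 0}.
Proof.
move=> iu mu_ u0 uT.
have mE := measurable_gt0 mu_.
have [E0|E1] : mu [set x | 0 < u x] = 0%E \/ mu [set x | 0 < u x] = 1%E.
  by apply: (ergodic_ae_invariant TP) => //; apply: filterS uT => x /= <-.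
- apply: (@ae_eq0_of_norm u (-1)) => //; apply: filterS (ae_measure0 mE E0) => x /= /negP.
  by rewrite -leNgt => ux; rewrite ler0_norm// mulN1r.
- apply: (@ae_eq0_of_norm u 1) => //; apply: filterS (measure1_ae mE E1) => x /= ux.
  by rewrite gtr0_norm// mul1r.
Qed.

Lemma rotation_factor_exists (f : bmfun X R) t e : 0 < e ->
  (forall x, `|f x| <= 1) -> \int[mu]_x f x = 0 ->
  (forall k, e <= spectral_avg (l2ip mu) (koopman TP) f (2 ^ k) t) ->
  exists rho alpha, rotation_factor mu T rho alpha.
Proof.
move=> e0 f1 f0 he.
have [a [b [ma mb ab abN0 /(_ f0)[ia ib a0 b0]]]] := eigenfunction_exists e0 f1 he.
have p0 : pi *+ 2 != 0 :> R by rewrite mulrn_eq0/= gt_eqF// pi_gt0.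
pose n2 x := a x ^+ 2 + b x ^+ 2.
have mn2 : measurable_fun setT n2 by apply: measurable_funD; apply: measurable_funX.
have mZ := measurable_gt0 mn2.
have n2T : {ae mu, forall x, n2 x = n2 (T x)}.
  apply: filterS ab => x [ax bx]; rewrite /n2 ax bx.
  have := cos2Dsin2 t; set c := cos t; set s := sin t => cs.
  transitivity ((c ^+ 2 + s ^+ 2) * (a (T x) ^+ 2 + b (T x) ^+ 2)); first by ring.
  by rewrite cs mul1r.
have nz : {ae mu, forall x, 0 < n2 x}.
  have [Z0|Z1] : mu [set x | 0 < n2 x] = 0%E \/ mu [set x | 0 < n2 x] = 1%E.
  - by apply: (ergodic_ae_invariant TP) => //; apply: filterS n2T => x /= <-.
  - exfalso; apply: abN0; apply: filterS (ae_measure0 mZ Z0) => x /= /negP.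
    rewrite -leNgt /n2 => h.
    have : a x ^+ 2 + b x ^+ 2 == 0 by rewrite eq_le h addr_ge0 ?sqr_ge0.
    by rewrite paddr_eq0 ?sqr_ge0// !sqrf_eq0 => /andP[/eqP -> /eqP ->].
  - exact: measure1_ae.
(* From [z = e^(i t) (z o T)] the argument of [z] changes by [- t] under [T]; [alpha] is this change
   in turns, reduced modulo 1. *)
pose q := - (t / (pi *+ 2)).
pose alpha := q - (Num.floor q)%:~R.
have alpha_itv : 0 <= alpha < 1.
  have /andP[h1 h2] := floor_itv q; rewrite intrD in h2.
  by rewrite /alpha; apply/andP; split; lra.
have tE : t = - (pi *+ 2 * alpha) + pi *+ 2 * (- Num.floor q)%:~R.
  rewrite mulrNz mulrN -opprD -mulrDr subrK /q mulrN opprK mulrC divfK//.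
(* With [alpha = 0], [a] and [b] would be invariant of mean zero and so vanish. This is where the
   zero mean of [f] enters. *)
have alpha0 : alpha != 0.
  apply/eqP => al0; apply: abN0.
  have [ct st] : cos t = 1 /\ sin t = 0.
    have [E1 E2] := cos_sin_period (- Num.floor q) (0 : R).
    by rewrite tE al0 mulr0 oppr0 E1 E2 cos0 sin0.
  have h1 : {ae mu, forall x, a x = 0}.
    apply: (ergodic_invariant_mean0 ia ma a0); apply: filterS ab => x [ax _].
    by rewrite {1}ax ct st mul1r mul0r subr0.
  have h2 : {ae mu, forall x, b x = 0}.
    apply: (ergodic_invariant_mean0 ib mb b0); apply: filterS ab => x [_ bx].
    by rewrite {1}bx ct st mul1r mul0r add0r.
  by apply: filterS2 h1 h2.
clearbody alpha; have /andP[al_ge0 al_lt1] := alpha_itv.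
exists (fun x => turn (a x) (b x)), alpha; split=> //.
- exact: measurable_turn.
- by move=> x; exact: turn_itv.
- by rewrite al_lt1 andbT lt_neqAle eq_sym alpha0.
have pne (u v : R) : 0 < u ^+ 2 + v ^+ 2 -> (u, v) != (0, 0).
  by apply: contraTneq => -[-> ->]; rewrite !expr0n addr0 ltxx.
apply: filterS3 ab nz n2T => x [ax bx] nx nT.
have nTx : 0 < n2 (T x) by rewrite -nT.
have /= [] := turnP (pne _ _ nx); rewrite -/(n2 x).
set r := Num.sqrt _ => r0; set w := turn (a x) (b x) => aE bE.
have /= [] := turnP (pne _ _ nTx); rewrite -/(n2 (T x)) -nT -/r.
set w' := turn (a (T x)) (b (T x)) => _ aE' bE'.
have rn0 : r != 0 by rewrite gt_eqF.
have [k E] : exists k : int, pi *+ 2 * w = pi *+ 2 * w' + t + pi *+ 2 * k%:~R.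
  apply: cos_sin_inj; apply: (mulfI rn0).
    by rewrite -aE ax aE' bE' cosD; ring.
  by rewrite -bE bx aE' bE' sinD; ring.
have {}E : w' = w + alpha + (Num.floor q - k)%:~R.
  apply: (mulfI p0); rewrite mulrDr mulrDr.
  move: E; rewrite {1}tE intrB mulrBr mulrNz mulrN.
  by move: (pi *+ 2 * w) (pi *+ 2 * w') (pi *+ 2 * alpha) (pi *+ 2 * k%:~R)
    (pi *+ 2 * (Num.floor q)%:~R) => *; lra.
have /andP[w0 w1] : 0 <= w < 1 := turn_itv _ _.
have /andP[w'0 w'1] : 0 <= w' < 1 := turn_itv _ _.
(* Both arguments lie in [[0, 1[], which leaves 0 or -1 for this integer; -1 occurs exactly when the
   step wraps around. *)
move: E; set z := (_ - k) => E.
have z1 : z%:~R < 1 :> R by lra.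
have z2 : - 2 < z%:~R :> R by lra.
have [z0|z0] := intr_gtN2_lt1 z2 z1; rewrite E z0 ?addr0.
  rewrite z0 addr0 in E.
  by rewrite (_ : (1 - alpha <= w) = false) ?subr0//; apply/negbTE; rewrite -ltNge; lra.
rewrite z0 in E.
by rewrite (_ : (1 - alpha <= w) = true)//; move: E; rewrite mulrNz => E; lra.
Qed.

End rotation_factor_exists.

Theorem theorem1p2 (d : measure_display) (X : measurableType d)
  (R : realType) (mu : probability X R) (T : X -> X) :
  lebesgue_space mu ->
  measure_preserving mu T ->
  ergodic mu T ->
  (forall (k : nat) (P : 'I_k -> set X),
     finite_meas_partition P -> nontrivial_partition mu P ->
     {ae mu, forall x, (1 <= lower_rec_rate (R:=R) T P x)%E}) ->
  weakly_mixing mu T.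
Proof.
move=> _ TP erg Hrec A B mA mB.
have indic_bm (C : set X) : measurable C -> (\1_C : X -> R) \in @bounded_measurable d X R.
  move=> mC; apply/bounded_measurableP; split; first exact: measurable_indic.
  by exists 1 => x; rewrite indicE; case: (_ \in _); rewrite ?normr0 ?normr1.
have int_indic (C : set X) : measurable C -> \int[mu]_x (\1_C x : R) = fine (mu C).
  by move=> mC; rewrite /Rintegral integral_indic// setIT.
pose a := fine (mu A).
have fP : (\1_A - (fun=> a) : X -> R) \in @bounded_measurable d X R.
  exact: rpredB (indic_bm _ mA) (bounded_measurable_cst _ _).
pose f := Bmfun fP; pose h := Bmfun (indic_bm _ mB).
have /andP[a0 a1] : 0 <= a <= 1.
  rewrite /a fine_ge0//= -lee_fin fineK ?fin_num_measure//.
  exact: probability_le1.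
have f1 x : `|f x| <= 1.
  rewrite -[f x]/(\1_A x - a) indicE; case: (_ \in _); rewrite /= ler_norml.
    by apply/andP; split; lra.
  by apply/andP; split; lra.
have iA C (mC : measurable C) := bounded_measurable_integrable mu (indic_bm C mC).
have ic c := bounded_measurable_integrable mu (bounded_measurable_cst X c).
have f0 : \int[mu]_x f x = 0.
  rewrite -[LHS]/(\int[mu]_x (\1_A x - a)) (RintegralB measurableT (iA _ mA) (ic a)).
  rewrite int_indic// (_ : \int[mu]_x a = a) ?subrr//.
  by rewrite Rintegral_cst// [X in fine X](_ : _ = 1%E) ?mulr1//; exact: probability_setT.
have corr j : l2ip mu (iter j (koopman TP) f) h =
    fine (mu (iter j T @^-1` A `&` B)) - fine (mu A) * fine (mu B).
  have mTA := measurable_preimage_iter TP j mA.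
  transitivity (\int[mu]_x (\1_(iter j T @^-1` A `&` B) x - a * \1_B x)).
    apply: eq_Rintegral => x _; rewrite iter_koopman.
    rewrite -[f _]/(\1_A (iter j T x) - a) -[h x]/(\1_B x) mulrBl; congr (_ - _).
    by rewrite indicI.
  have mTAB := measurableI _ _ mTA mB.
  have iaB := bounded_measurable_integrable mu (rpredZ a (indic_bm _ mB)).
  rewrite (RintegralB measurableT (iA _ mTAB) iaB).
  by rewrite (RintegralZl _ measurableT (iA _ mB)) !int_indic.
have := @correlation_cesaro_cvg0 R _ _ (l2ip_semi_inner mu) _ (koopman_isometry TP) f h.
under eq_fun do under eq_bigr do rewrite corr.
(* If the spectral averages of [f] at some [t] never fell below [e], a rotation factor would exist,
   against the recurrence hypothesis. *)
apply => t e e0; apply: contrapT => /forallNP hk.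
have [|rho [alpha rf]] := @rotation_factor_exists _ _ _ _ _ TP erg f t e e0 f1 f0.
  by move=> k; rewrite leNgt; apply/negP/hk.
exact: (no_rotation_factor TP rf Hrec).
Qed.
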